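(* Let $n\ge 3$ be an integer and let $\ell=\operatorname{lcm}(4,n)$. The automorphism group of the minimal regular cover of the $n$-prism, with its distinguished generators $a,b,c$ (in this order, i.e. $a=\rho_0$, $b=\rho_1$, $c=\rho_2$), is the Coxeter group $[\ell,3]$ subject to the single extra relation $(c(ab)^2c(ab)^3)^2=id$; that is, it is the group with presentation $$\langle a,b,c \mid a^2=b^2=c^2=(ac)^2=(bc)^3=(ab)^{\ell}=(c(ab)^2c(ab)^3)^2=id\rangle .$$
   Context: An abstract polyhedron $\mathcal{P}$ is a partially ordered set such that: (P1) it has a unique minimum face $F_{-1}$ and a unique maximum face $F_3$; (P2) every maximal totally ordered subset (flag) contains $F_{-1}$ and $F_3$ and has exactly $5$ elements (so there is a rank function; the elements of rank $0,1,2$ are vertices, edges, faces); (P3) it is strongly connected, meaning every section $G/F=\{H: F\le H\le G\}$ is connected, where a poset of rank $n$ is connected if $n\le 1$ or any two of its proper faces are joined by a finite sequence of proper faces with consecutive ones incident (comparable); (P4) every edge is incident to exactly two vertices and exactly two faces, and if a vertex $V$ is incident to a face $F$ there are exactly two edges incident to both. For a flag $\Psi$ and $i\in\{0,1,2\}$, $\Psi^i$ denotes the unique flag differing from $\Psi$ exactly in its element of rank $i$ (the $i$-adjacent flag). $\Gamma(\mathcal{P})$ is the automorphism group of $\mathcal{P}$; $\mathcal{P}$ is regular if $\Gamma(\mathcal{P})$ is transitive on flags. For a regular $\mathcal{P}$ with base flag $\Phi$, the distinguished generators of $\Gamma(\mathcal P)$ are the involutions $\rho_i$ with $\Phi\rho_i=\Phi^i$,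 $i=0,1,2$. The monodromy group $\mathrm{Mon}(\mathcal{Q})=\langle r_0,r_1,r_2\rangle$ of a polyhedron $\mathcal Q$ is the group of permutations of its flags generated by $r_i:\Psi\mapsto\Psi^i$, acting on the right (words are read from left to right). A regular polyhedron $\mathcal{P}$ covers $\mathcal{Q}$ if there is a group homomorphism $\Gamma(\mathcal{P})\to\mathrm{Mon}(\mathcal{Q})$ with $\rho_i\mapsto r_i$ for $i=0,1,2$. $\mathcal{P}$ is a minimal regular cover of $\mathcal{Q}$ if $\mathcal{P}$ is regular, covers $\mathcal{Q}$, and any regular polyhedron $\mathcal{R}$ that covers $\mathcal{Q}$ and is covered by $\mathcal{P}$ equals $\mathcal{P}$. (It is known that every polyhedron $\mathcal{Q}$ has a unique minimal regular cover up to isomorphism, namely the regular polyhedron whose automorphism group with distinguished generators is $\mathrm{Mon}(\mathcal{Q})$ with generators $r_0,r_1,r_2$, whenever $\mathrm{Mon}(\mathcal Q)$ is a string C-group; this always holds for polyhedra.) The $n$-prism is the face lattice of the convex $n$-gonal prism: vertices $u_i,v_i$ ($i\in\mathbb{Z}/n$), edges $u_iu_{i+1}$, $v_iv_{i+1}$, $u_iv_i$, and faces the two $n$-gons $u_0\cdots u_{n-1}$, $v_0\cdots v_{n-1}$ and the $n$ squares $u_iu_{i+1}v_{i+1}v_i$. The Coxeter group $[p,q]$ is $\langle a,b,c\mid a^2=b^2=c^2=(ac)^2=(ab)^p=(bc)^q=id\rangle$. *)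

(* Defs.v *)
From HB Require Import structures.
From mathcomp Require Import all_boot all_order all_algebra.
From mathcomp Require Import boolp classical_sets cardinality.

Set Implicit Arguments.
Unset Strict Implicit.
Unset Printing Implicit Defensive.

Import Order.TTheory.

Local Open Scope classical_set_scope.
Local Open Scope card_scope.
Local Open Scope order_scope.

(* The group of all permutations of a possibly infinite type. The library's
   {perm T} needs T finite. Permutations act on the right: the product s * t
   is s followed by t. *)
Record Sym (X : Type) := MkSym {
  sym_fun :> X -> X;
  sym_inv : X -> X;
  sym_funK : cancel sym_fun sym_inv;
  sym_invK : cancel sym_inv sym_fun }.

HB.instance Definition _ X := gen_eqMixin (Sym X).
HB.instance Definition _ X := gen_choiceMixin (Sym X).

Lemma symP X (s t : Sym X) : s =1 t -> s = t.
Proof.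
case: s t => [f f' fK f'K] [g g' gK g'K] /= /funext fg.
move: fK f'K; rewrite {}fg => fK f'K.
have fg' : f' = g' by apply: funext => x; rewrite -[in RHS](f'K x) gK.
move: fK f'K; rewrite {}fg' => fK f'K.
by congr MkSym; apply: Prop_irrelevance.
Qed.

Section SymGroup.
Variable X : Type.
Implicit Types s t : Sym X.

Definition sym_one : Sym X := @MkSym X id id (fun=> erefl) (fun=> erefl).
Definition sym_opp s : Sym X := MkSym (sym_invK s) (sym_funK s).
Definition sym_mul s t : Sym X :=
  @MkSym X (t \o s) (sym_inv s \o sym_inv t)
    (can_comp (sym_funK t) (sym_funK s)) (can_comp (sym_invK s) (sym_invK t)).

Lemma sym_mulA : associative sym_mul.
Proof. by move=> s t u; apply: symP. Qed.
Lemma sym_mul1s : left_id sym_one sym_mul.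
Proof. by move=> s; apply: symP. Qed.
Lemma sym_muls1 : right_id sym_one sym_mul.
Proof. by move=> s; apply: symP. Qed.
Lemma sym_mulVs : left_inverse sym_one sym_opp sym_mul.
Proof. by move=> s; apply: symP => x /=; rewrite sym_invK. Qed.
Lemma sym_mulsV : right_inverse sym_one sym_opp sym_mul.
Proof. by move=> s; apply: symP => x /=; rewrite sym_funK. Qed.

HB.instance Definition _ := isGroup.Build (Sym X)
  sym_mulA sym_mul1s sym_muls1 sym_mulVs sym_mulsV.
End SymGroup.

Definition is_subgroup (G : groupType) (S : set G) : Prop :=
  S 1%g /\ forall x y : G, S x -> S y -> S (x / y)%g.

Definition generated (G : groupType) (X : set G) : set G :=
  smallest (@is_subgroup G) X.

(* The structure tbPOrderType provides the unique minimum face \bot (= F_{-1}) and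
   the unique maximum face \top (= F_3). *)
Section Polyhedron.
Context {d : Order.disp_t} {T : tbPOrderType d}.
Implicit Types (A B : set T) (x y F G : T).

Definition chain A : Prop := total_on A (fun x y => x <= y).

Definition is_flag A : Prop :=
  chain A /\ forall B, chain B -> A `<=` B -> B = A.

(* The common value, over the flags A through x, of the number of elements of A
   below x, minus 1 (so that \bot has rank -1); 0 if no flag through x has
   finitely many elements below x. *)
Definition rank x : int :=
  xget 0%R [set r | exists A n, [/\ is_flag A, A x,
                      [set y | A y /\ y < x] #= `I_n & r = (n%:Z - 1)%R]].

Definition incident x y : bool := x >=< y.

Definition in_section F G x : bool := F < x < G.

(* The section G/F has rank (rank G - rank F - 1). *)
Definition connected_section F G : Prop :=
  (rank G - rank F - 1 <= 1)%R \/
  forall x y, in_section F G x -> in_section F G y ->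
    exists s : seq T,
      [/\ path incident x s, all (in_section F G) s & last x s = y].

Record is_polyhedron : Prop := IsPolyhedron {
  flags_have_5_elements :
    forall A, is_flag A -> [/\ A \bot, A \top & A #= `I_5];
  strongly_connected :
    forall F G, F <= G -> connected_section F G;
  edge_two_vertices :
    forall e, rank e = 1%R -> [set v | rank v = 0%R /\ incident v e] #= `I_2;
  edge_two_faces :
    forall e, rank e = 1%R -> [set f | rank f = 2%R /\ incident e f] #= `I_2;
  vertex_face_two_edges :
    forall v f, rank v = 0%R -> rank f = 2%R -> incident v f ->
      [set e | [/\ rank e = 1%R, incident v e & incident e f]] #= `I_2 }.

End Polyhedron.

Arguments is_polyhedron {d} T.

Record flag {d : Order.disp_t} (T : tbPOrderType d) := Flag {
  flag_set :> set T;
  flagP : is_flag flag_set }.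

HB.instance Definition _ d (T : tbPOrderType d) := gen_eqMixin (flag T).
HB.instance Definition _ d (T : tbPOrderType d) := gen_choiceMixin (flag T).

Definition is_automorphism d (T : tbPOrderType d) (g : Sym T) : bool :=
  `[< {mono g : x y / x <= y} >].

Record Aut d (T : tbPOrderType d) := MkAut {
  aut_perm :> Sym T;
  autP : is_automorphism aut_perm }.

HB.instance Definition _ d (T : tbPOrderType d) :=
  [isSub for @aut_perm d T].
HB.instance Definition _ d (T : tbPOrderType d) :=
  [Choice of Aut T by <:].

Lemma aut_group_closed d (T : tbPOrderType d) :
  group_closed (@is_automorphism d T).
Proof.
split; first by apply/asboolP.
move=> g h /asboolP gM /asboolP hM; apply/asboolP => x y /=.
by rewrite -hM !sym_invK gM.
Qed.

HB.instance Definition _ d (T : tbPOrderType d) :=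
  SubChoice_isSubGroup.Build (Sym T) (@is_automorphism d T) (Aut T)
    (@aut_group_closed d T).

(* In the rest of this file the defaults of xget (Psi, resp. 1) are never
   reached when the axioms of a polyhedron, resp. regularity, hold: the element
   described by the set then exists and is unique. *)

Definition adjacent d (T : tbPOrderType d) (i : 'I_3) (Psi Psi' : flag T) :
    Prop :=
  Psi' <> Psi /\
  forall x : T, rank x <> (i : nat)%:Z%R -> (flag_set Psi' x <-> flag_set Psi x).

Definition adj d (T : tbPOrderType d) (i : 'I_3) (Psi : flag T) : flag T :=
  xget Psi [set Psi' | adjacent i Psi Psi'].

Definition is_regular d (P : tbPOrderType d) : Prop :=
  is_polyhedron P /\
  forall Phi Psi : flag P, exists g : Aut P, g @` Phi = flag_set Psi.

Definition rho d (P : tbPOrderType d) (Phi : flag P) (i : 'I_3) : Aut P :=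
  xget 1%g [set g : Aut P | g @` Phi = flag_set (adj i Phi)].

Definition mon_gen d (Q : tbPOrderType d) (i : 'I_3) : Sym (flag Q) :=
  xget 1%g [set s : Sym (flag Q) | forall Psi, s Psi = adj i Psi].

Definition in_mon d (Q : tbPOrderType d) (s : Sym (flag Q)) : bool :=
  `[< generated (range (@mon_gen d Q)) s >].

Record Mon d (Q : tbPOrderType d) := MkMon {
  mon_perm :> Sym (flag Q);
  monP : in_mon mon_perm }.

HB.instance Definition _ d (Q : tbPOrderType d) :=
  [isSub for @mon_perm d Q].
HB.instance Definition _ d (Q : tbPOrderType d) :=
  [Choice of Mon Q by <:].

Lemma mon_group_closed d (Q : tbPOrderType d) : group_closed (@in_mon d Q).
Proof.
split; first by apply/asboolP => S [[S1 _] _].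
move=> g h /asboolP gM /asboolP hM; apply/asboolP => S SX.
by case: (SX) => -[_ SF] _; apply: SF; [apply: gM | apply: hM].
Qed.

HB.instance Definition _ d (Q : tbPOrderType d) :=
  SubChoice_isSubGroup.Build (Sym (flag Q)) (@in_mon d Q) (Mon Q)
    (@mon_group_closed d Q).

(* P is meant to be regular, with base flag Phi. *)
Definition covers dP (P : tbPOrderType dP) (Phi : flag P)
    dQ (Q : tbPOrderType dQ) : Prop :=
  exists f : {multiplicative Aut P -> Mon Q},
    forall i : 'I_3, mon_perm (f (rho Phi i)) = mon_gen Q i.

Definition isomorphic dP (P : tbPOrderType dP) dR (R : tbPOrderType dR) :
    Prop :=
  exists f : P -> R, bijective f /\ {mono f : x y / x <= y}.

Definition minimal_regular_cover dP (P : tbPOrderType dP) (Phi : flag P)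
    dQ (Q : tbPOrderType dQ) : Prop :=
  [/\ is_regular P, covers Phi Q &
      forall dR (R : tbPOrderType dR) (Psi : flag R),
        is_regular R -> covers Psi Q -> covers Phi R -> isomorphic R P].

(* A face of the prism is represented by the set of its vertices; the order of
   the face lattice is then inclusion, set0 being F_{-1} and setT being F_3. *)
Section Prism.
Variable n : nat.

Definition prism_vertex : finType := (bool * 'Z_n)%type.
Definition prism_u (i : 'Z_n) : prism_vertex := (false, i).
Definition prism_v (i : 'Z_n) : prism_vertex := (true, i).

Definition is_prism_face (A : {set prism_vertex}) : bool :=
  [|| A == finset.set0,
      [exists i, (A == [set prism_u i]%SET) || (A == [set prism_v i]%SET)],
      [exists i, [|| A == [set prism_u i; prism_u (i + 1)%R]%SET,
                     A == [set prism_v i; prism_v (i + 1)%R]%SET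
                   | A == [set prism_u i; prism_v i]%SET]],
      A == [set prism_u i | i : 'Z_n]%SET,
      A == [set prism_v i | i : 'Z_n]%SET,
      [exists i, A == [set prism_u i; prism_u (i + 1)%R; prism_v (i + 1)%R; prism_v i]%SET]
    | A == finset.setT].

Record prism := Prism {
  prism_set :> {set prism_vertex};
  prism_setP : is_prism_face prism_set }.

HB.instance Definition _ := [isSub for prism_set].
HB.instance Definition _ := [Finite of prism by <:].

Definition prism_le (A B : prism) : bool := prism_set A \subset prism_set B.

Lemma prism_le_refl : reflexive prism_le.
Proof. by move=> A; apply: fintype.subxx. Qed.
Lemma prism_le_anti : antisymmetric prism_le.
Proof. by move=> A B AB; apply: val_inj; apply/eqP; rewrite finset.eqEsubset. Qed.
Lemma prism_le_trans : transitive prism_le.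
Proof. by move=> B A C; apply: fintype.subset_trans. Qed.

Fact prism_display : Order.disp_t. Proof. exact: (Order.Disp tt tt). Qed.

HB.instance Definition _ := Order.Le_isPOrder.Build prism_display prism
  prism_le_refl prism_le_anti prism_le_trans.

Lemma prism_bot_subproof : is_prism_face finset.set0.
Proof. by rewrite /is_prism_face eqxx. Qed.
Lemma prism_top_subproof : is_prism_face finset.setT.
Proof. by rewrite /is_prism_face eqxx !orbT. Qed.

Lemma prism_le0 (A : prism) : Prism prism_bot_subproof <= A.
Proof. exact: finset.sub0set. Qed.
Lemma prism_le1 (A : prism) : A <= Prism prism_top_subproof.
Proof. exact: finset.subsetT. Qed.

HB.instance Definition _ :=
  Order.hasBottom.Build prism_display prism prism_le0.
HB.instance Definition _ :=
  Order.hasTop.Build prism_display prism prism_le1.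
End Prism.

(* A word in the generators i : I is a sequence of letters
   (i, e), where (i, false) stands for i and (i, true) for its inverse. *)
Definition word (I : Type) := seq (I * bool).

Section Words.
Variable I : Type.
Implicit Types w : word I.

Definition letter (i : I) : word I := [:: (i, false)].
Definition wexp w (k : nat) : word I := flatten (nseq k w).

(* Equality of words in the group <I | R>. *)
Inductive pres_eq (R : word I -> Prop) : word I -> word I -> Prop :=
| pres_refl w : pres_eq R w w
| pres_sym w w' : pres_eq R w w' -> pres_eq R w' w
| pres_trans w w' w'' : pres_eq R w w' -> pres_eq R w' w'' -> pres_eq R w w''
| pres_cat w1 w1' w2 w2' :
    pres_eq R w1 w1' -> pres_eq R w2 w2' -> pres_eq R (w1 ++ w2) (w1' ++ w2')
| pres_cancel i e : pres_eq R [:: (i, e); (i, ~~ e)] [::]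
| pres_rel w : R w -> pres_eq R w [::].

Definition eval (G : groupType) (g : I -> G) w : G :=
  (\prod_(l <- w) (if l.2 then (g l.1)^-1 else g l.1))%g.

(* G = <I | R>, the generator i being mapped to g i: evaluation of words induces
   an isomorphism from the presented group onto G. *)
Definition has_presentation (G : groupType) (g : I -> G)
    (R : word I -> Prop) : Prop :=
  (forall x : G, exists w, eval g w = x) /\
  (forall w w', eval g w = eval g w' <-> pres_eq R w w').

End Words.

Definition word_a : word 'I_3 := letter (@Ordinal 3 0 isT).
Definition word_b : word 'I_3 := letter (@Ordinal 3 1 isT).
Definition word_c : word 'I_3 := letter (@Ordinal 3 2 isT).

Definition coxeter_relators (p q : nat) : seq (word 'I_3) :=
  [:: wexp word_a 2; wexp word_b 2; wexp word_c 2; wexp (word_a ++ word_c) 2;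
      wexp (word_a ++ word_b) p; wexp (word_b ++ word_c) q].

Definition extra_relator : word 'I_3 :=
  wexp (word_c ++ wexp (word_a ++ word_b) 2 ++ word_c ++ wexp (word_a ++ word_b) 3) 2.

(* Main.v *)
From mathcomp Require Import all_boot fingroup perm.
Require Import Defs.
From HB Require Import structures.
From mathcomp Require Import all_boot all_order all_algebra.
From mathcomp Require Import generic_quotient zify ring.
From mathcomp Require Import boolp classical_sets cardinality.

Set Implicit Arguments.
Unset Strict Implicit.
Unset Printing Implicit Defensive.

Import Order.TTheory GRing.Theory.

Local Open Scope classical_set_scope.
Local Open Scope card_scope.
Local Open Scope order_scope.

(** Write Q for the n-prism. A word in the three adjacencies describes a walk on the
flags of any polyhedron. Three facts about such walks reduce the theorem to group
theory. The words that return to the base flag are exactly the relations between the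
distinguished generators of a regular polyhedron ([eval_rho_eq1]). They determine the
polyhedron, since a face of rank i is a class of flags under the walks that avoid the
adjacency i ([iso_of_walks]). And a regular polyhedron covers Q exactly when each of its
returning words fixes every flag of Q ([covers_walks]). So a regular polyhedron whose
returning words are the words that fix every flag of Q is the minimal regular cover, up
to isomorphism, and it remains to construct one and to show that these words are the
consequences of the given relators.

Let a, b, c be the permutations r_0, r_1, r_2 of the flags of Q, and put x_0 = a,
x_1 = bab, x_2 = cbabc. As (ac)^2 = (bc)^3 = 1, the elements b and c generate a group S_3
that permutes x_0, x_1, x_2 by conjugation, and Mon(Q) is the product of
N = <x_0, x_1, x_2> and S_3. The faces of the cover are the cosets vW_J in N, where W_J is
generated by the x_j with j in J; the rank of vW_J is |J|. A flag is then an element v of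
N with an ordering of the three generators, that is, an element of N S_3, and going to
an adjacent flag is right multiplication by a, b or c ([coset_walk]). All that this
needs is that no x_j lies in the group generated by the others and that S_3 meets N
trivially. Both can be seen on the flags of Q, which are of three types: the edge of a
flag is a rung (type 0), or its face is a square but its edge is not a rung (type 1), or
its face is an n-gon (type 2). The involution x_j preserves types, and it exchanges the
two n-gons on the flags of type j only ([dart_reflection]).

For the presentation, the extra relator says that x_2 commutes with s = (x_0 x_1)^2
([extra_relator_commute]). Conjugating by S_3, each x_j commutes with the squared product
of the other two, so s, t = (x_1 x_2)^2 and u = (x_2 x_0)^2 generate an abelian normal
subgroup, modulo which the x_j commute. Hence each element of the presented group is
s^m1 t^m2 u^m3 x_0^e x_1^f x_2^h times one of six elements of S_3 ([normal_form]). If it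
acts trivially on the flags of Q, then the types show that the last factor is 1, the
n-gons show that e = f = h = 0, and as s turns the flags of type 2 by four steps along
their n-gon and fixes the others, n divides 4 m1 ([dart_normal]). Then lcm(4, n) divides
4 m1, and s^m1 = (ab)^(4 m1) = 1 in the presented group. The same holds for t and u,
because s, u, t are conjugate up to inversion. *)

Local Notation o0 := (@Ordinal 3 0 isT).
Local Notation o1 := (@Ordinal 3 1 isT).
Local Notation o2 := (@Ordinal 3 2 isT).

(** * Graded posets *)

Lemma card_seq (T : eqType) (s : seq T) : uniq s -> [set` s] #= `I_(size s).
Proof.
elim: s => [|x s IH] /= => [_|/andP[xs us]].
  by rewrite set_nil II0 card_eq00.
apply/eq_cardSP; exists x; first by rewrite /= mem_head.
rewrite (_ : _ `\ x = [set` s]); first exact: IH.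
apply/seteqP; split=> y /=; rewrite inE.
  by case=> /predU1P[->|].
by move=> ys; split; [rewrite ys orbT | move=> yx; rewrite -yx ys in xs].
Qed.

Section Chains.
Context {d : Order.disp_t} {T : tbPOrderType d}.
Implicit Types (A B C : set T) (x y z : T) (s : seq T).

(** Zorn's lemma is needed because the axioms of a polyhedron speak of flags only: that
each face lies in one has to be proved for an arbitrary, possibly infinite, poset. *)
Lemma chain_extends C : chain C -> exists2 A, is_flag A & C `<=` A.
Proof.
move=> Cc; have [F FP Ft|A [PA Amax]] := @Zorn_bigcup T [set B | chain (C `|` B)].
  move=> x y [Cx|[X FX Xx]] [Cy|[Y FY Yy]].
  - exact: Cc.
  - by apply: (FP _ FY); [left | right].
  - by apply: (FP _ FX); [right | left].
  - case: (Ft _ _ FX FY) => [XY|YX].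
      by apply: (FP _ FY); right => //; apply: XY.
    by apply: (FP _ FX); right => //; apply: YX.
have maxE B : chain B -> C `|` A `<=` B -> B `<=` A.
  move=> Bc sCAB; apply: contrapT => nBA; apply: (Amax B).
    by split=> // x Ax; apply: sCAB; right.
  rewrite /= (_ : (C `|` B)%classic = B) //.
  by apply/setUidPr => x Cx; apply: sCAB; left.
exists (C `|` A); last by move=> x; left.
split=> // B Bc sCAB; apply/seteqP; split=> // x Bx; right; exact: (maxE B).
Qed.

Lemma chain2 x y : x <= y -> chain [set z | z = x \/ z = y].
Proof.
by move=> xy u v [->|->] [->|->]; [left | left | right | left].
Qed.

Lemma chain_seq s : sorted <=%O s -> chain [set` s].
Proof.
move=> ss x y /= xs ys; rewrite -(nth_index x xs) -(nth_index x ys).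
have [le_ij|/ltnW le_ij] := leqP (index x s) (index y s); [left | right].
  by apply: (sorted_leq_nth le_trans le_refl) => //; rewrite inE index_mem.
by apply: (sorted_leq_nth le_trans le_refl) => //; rewrite inE index_mem.
Qed.

(** The usual way to exhibit an element of a flag: a flag is a maximal chain. *)
Lemma flag_chain_comp A z : is_flag A ->
  (forall x, A x -> x <= z \/ z <= x) -> A z.
Proof.
case=> Ac Amax Az; have <- : [set x | A x \/ x = z] = A.
  apply: Amax => [x y [Ax|->] [Ay|->]|x Ax]; [exact: Ac|exact: Az| |by left|by left].
  by case: (Az _ Ay); [right|left].
by right.
Qed.
End Chains.

(** Ranks are shifted by one, so that the minimum has rank 0 and the maximum rank 4. The
last clause forces a maximal chain to meet all ranks. *)
Definition graded d (T : tbPOrderType d) (r : T -> nat) : Prop :=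
  [/\ r \bot = 0%N, r \top = 4%N, forall x y, x < y -> (r x < r y)%N &
      forall x y, x < y -> ((r x).+1 < r y)%N -> exists2 z, x < z & z < y].

Section FiveElementFlags.
Context {d : Order.disp_t} {T : tbPOrderType d}.
Implicit Types (A B C : set T) (x y z : T) (s : seq T).
Hypothesis F5 : forall A, is_flag A -> [/\ A \bot, A \top & A #= `I_5].

Let sorted5 s := [/\ sorted <%O s, size s = 5%N, \bot \in s & \top \in s].

Let chain_in_sorted5 C : chain C -> exists2 s, sorted5 s & C `<=` [set` s].
Proof.
move=> /chain_extends[A Af CA]; have [Ab At A5] := F5 Af.
have /finite_seqP[s0 As0] : finite_set A by apply/finite_setP; exists 5%N.
pose s := sort <=%O (undup s0).
have sA : [set` s] = A.
  by rewrite As0; apply/seteqP; split=> x /=; rewrite mem_sort mem_undup.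
have us : uniq s by rewrite sort_uniq undup_uniq.
have memA x : (x \in s) = `[< A x >] by apply/idP/asboolP; rewrite -sA.
exists s; last by rewrite sA.
split; rewrite ?memA; try exact/asboolP.
  rewrite lt_sorted_uniq_le us /=; apply: (sort_sorted_in (P := fun x => `[< A x >])).
    by move=> x y /asboolP Ax /asboolP Ay; apply/orP; apply: Af.1.
  by apply/allP => x; rewrite -(mem_sort <=%O) -/s memA.
by apply/card_eq_II; apply: card_eq_trans A5; rewrite -sA card_esym // card_seq.
Qed.

Let size_sorted s : sorted <%O s -> (size s <= 5)%N.
Proof.
move=> ss; have [t [_ <- _ _] st] := chain_in_sorted5 (chain_seq (sub_sorted (@ltW _ _) ss)).
by apply: uniq_leq_size; [rewrite lt_sorted_uniq | apply: st].
Qed.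

Let nth_lt s i j : sorted <%O s -> (i < j < size s)%N -> nth \bot s i < nth \bot s j.
Proof.
move=> ss /andP[ij js]; apply: (sorted_ltn_nth lt_trans) => //; rewrite inE //.
exact: ltn_trans js.
Qed.

Let index_lt s x y : sorted <%O s -> x \in s -> y \in s -> x < y ->
  (index x s < index y s)%N.
Proof.
move=> ss xs ys xy; rewrite ltnNge leq_eqVlt; apply/negP => /orP[/eqP e|h].
  by move: xy; rewrite -(nth_index x xs) -e nth_index // ltxx.
have := @nth_lt s (index y s) (index x s) ss; rewrite h index_mem xs.
by rewrite !nth_index // => /(_ isT) /(lt_trans xy); rewrite ltxx.
Qed.

(* The part of s1 below x followed by the part of s2 from x on is again a chain,
   so it has at most 5 elements. *)
Let index_le s1 s2 x : sorted5 s1 -> sorted5 s2 -> x \in s1 -> x \in s2 ->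
  (index x s1 <= index x s2)%N.
Proof.
move=> [ss1 z1 _ _] [ss2 z2 _ _] x1 x2.
have sz1 : (index x s1 < 5)%N by rewrite -z1 index_mem.
have sz2 : (index x s2 < 5)%N by rewrite -z2 index_mem.
have := @size_sorted (take (index x s1) s1 ++ drop (index x s2) s2).
rewrite size_cat size_take size_drop z1 z2 sz1 => H; rewrite leqNgt.
apply/negP => lt12; suff /H : sorted <%O (take (index x s1) s1 ++ drop (index x s2) s2).
  by move: lt12 sz1 sz2; lia.
rewrite lt_sorted_pairwise pairwise_cat -!lt_sorted_pairwise.
rewrite take_sorted // drop_sorted // !andbT.
apply/allrelP => y z /(nthP \bot)[i]; rewrite size_take z1 sz1 => ix <-.
move=> /(nthP \bot)[j]; rewrite size_drop z2 => jx <-.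
rewrite nth_take // nth_drop; apply: (@lt_le_trans _ _ x).
  by rewrite -[ltRHS](nth_index \bot x1); apply: nth_lt; rewrite // ix z1 sz1.
rewrite -[leLHS](nth_index \bot x2); have [->|j0] := posnP j; first by rewrite addn0.
by rewrite ltW // nth_lt // z2 -[ltnLHS]addn0 ltn_add2l j0 -ltn_subRL.
Qed.

(** If all flags have five elements, then the position of x in a flag does not depend on
the flag, by the cut-and-paste argument of [index_le]. *)
Lemma five_element_flags_graded : exists r : T -> nat, graded r.
Proof.
have /choice[r rP] : forall x, exists n, forall s, sorted5 s -> x \in s ->
    index x s = n.
  move=> x; have [|s s5 xs] := @chain_in_sorted5 [set x].
    by move=> ? ? -> ->; left.
  have {}xs : x \in s by apply: xs.
  by exists (index x s) => t t5 xt; apply/eqP; rewrite eqn_leq !index_le.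
have pair x y : x <= y -> exists2 s, sorted5 s & x \in s /\ y \in s.
  move=> xy; have [s s5 xys] := chain_in_sorted5 (chain2 xy).
  by exists s => //; split; apply: xys; [left|right].
have [s0 s05 [b0 t0]] := pair _ _ (le0x (\top : T)).
have [ss0 z0 _ _] := s05.
exists r; split.
- rewrite -(rP _ s0) //; case E: (index _ _) => [|i] //.
  have := @nth_lt s0 0 i.+1 ss0; rewrite -E index_mem b0 E => /(_ isT).
  by rewrite -E nth_index // ltx0.
- rewrite -(rP _ s0) //.
  have : (index \top s0 < 5)%N by rewrite -z0 index_mem.
  rewrite ltnS leq_eqVlt => /predU1P[//|lt4].
  have := @nth_lt s0 (index \top s0) 4 ss0; rewrite z0 lt4 => /(_ isT).
  by rewrite nth_index // lt1x.
- move=> x y xy; have [s s5 [xs ys]] := pair _ _ (ltW xy).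
  by rewrite -(rP _ s) // -(rP y s) //; apply: index_lt => //; case: s5.
- move=> x y xy; have [s s5 [xs ys]] := pair _ _ (ltW xy); have [ss zs _ _] := s5.
  rewrite -(rP _ s) // -(rP y s) // => h; exists (nth \bot s (index x s).+1).
    rewrite -[ltLHS](nth_index \bot xs) nth_lt // ltnSn /=.
    by rewrite (ltn_trans h) // index_mem.
  by rewrite -[ltRHS](nth_index \bot ys) nth_lt // h index_mem.
Qed.
End FiveElementFlags.

Section Graded.
Context {d : Order.disp_t} {T : tbPOrderType d}.
Variable r : T -> nat.
Hypothesis r_graded : graded r.
Implicit Types (A B C : set T) (x y z : T).

Lemma grade_le4 x : (r x <= 4)%N.
Proof.
case: r_graded => _ rt rlt _; rewrite -rt; have := lex1 x.
by rewrite le_eqVlt => /predU1P[->//|/rlt/ltnW].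
Qed.

Lemma flag_bot A : is_flag A -> A \bot.
Proof. by move=> Af; apply: flag_chain_comp => // x _; right; apply: le0x. Qed.

Lemma flag_top A : is_flag A -> A \top.
Proof. by move=> Af; apply: flag_chain_comp => // x _; left; apply: lex1. Qed.

Lemma flag_grade_inj A x y : is_flag A -> A x -> A y -> r x = r y -> x = y.
Proof.
move=> [Ac _] Ax Ay e; have [_ _ rlt _] := r_graded.
have nlt u v : r u = r v -> u <= v -> u = v.
  by rewrite le_eqVlt => ruv /predU1P[//|/rlt]; rewrite ruv ltnn.
by case: (Ac _ _ Ax Ay) => [/nlt|/nlt-/(_ (esym e))//]; apply.
Qed.

Lemma flag_grade_le A x y : is_flag A -> A x -> A y -> (r x <= r y)%N -> x <= y.
Proof.
move=> Af Ax Ay; have [_ _ rlt _] := r_graded.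
case: (Af.1 _ _ Ax Ay) => //; rewrite le_eqVlt => /predU1P[->//|/rlt].
by rewrite ltnNge => /negbTE->.
Qed.

(** If a flag skipped the rank i, an element could be inserted between its last element of
rank below i and its first element of rank above i, against the maximality of the flag. *)
Lemma flag_grade_onto A i : is_flag A -> (i <= 4)%N -> exists2 x, A x & r x = i.
Proof.
move=> Af i4; have [r0 r4 rlt rgap] := r_graded; apply: contrapT => noi.
have neqi x : A x -> r x != i by move=> Ax; apply/eqP => e; apply: noi; exists x.
pose L j := `[< exists2 x, A x & r x = j >] && (j < i)%N.
pose U j := `[< exists2 x, A x & r x = j >] && (i < j)%N.
have exL : exists j, L j.
  exists 0%N; apply/andP; split; first by apply/asboolP; exists \bot; first exact: flag_bot.
  by rewrite lt0n eq_sym -r0 neqi //; apply: flag_bot.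
have exU : exists j, U j.
  exists 4%N; apply/andP; split; first by apply/asboolP; exists \top; first exact: flag_top.
  by rewrite ltn_neqAle i4 eq_sym -r4 neqi //; apply: flag_top.
have [|p /andP[/asboolP[x Ax <-] xi] pmax] := ex_maxnP exL (m := 4).
  by move=> j /andP[_ ji]; rewrite (leq_trans (ltnW ji)).
have [q /andP[/asboolP[y Ay <-] iy] qmin] := ex_minnP exU.
have xy : x < y.
  rewrite lt_neqAle (flag_grade_le Af) ?(leq_trans (ltnW xi)) ?(ltnW iy) // andbT.
  by apply: contraTneq xi => ->; rewrite -leqNgt ltnW.
have [z xz zy] := rgap _ _ xy (leq_ltn_trans xi iy).
have Az : A z.
  apply: flag_chain_comp => // w Aw; have := neqi _ Aw.
  rewrite neq_ltn => /orP[wi|iw]; [left | right].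
    apply: le_trans (ltW xz); apply: (flag_grade_le Af) => //; apply: pmax.
    by rewrite /L wi andbT; apply/asboolP; exists w.
  apply: le_trans (ltW zy) _; apply: (flag_grade_le Af) => //; apply: qmin.
  by rewrite /U iw andbT; apply/asboolP; exists w.
have := neqi _ Az; rewrite neq_ltn => /orP[zi|iz].
  have := rlt _ _ xz; rewrite ltnNge pmax // /L zi andbT; apply/asboolP.
  by exists z.
have := rlt _ _ zy; rewrite ltnNge qmin // /U iz andbT; apply/asboolP.
by exists z.
Qed.

Lemma card_flag_below A x : is_flag A -> A x -> [set y | A y /\ y < x] #= `I_(r x).
Proof.
move=> Af Ax; have [_ _ rlt _] := r_graded.
rewrite (_ : `I_(r x) = r @` [set y | A y /\ y < x]).
  apply/card_esym/inj_card_eq => y z; rewrite !inE => -[Ay _] [Az _].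
  exact: (flag_grade_inj Af).
apply/seteqP; split=> [i /= ix|_ [y [_ yx] <-]]; last exact: rlt.
have [|y Ay ry] := flag_grade_onto Af (i := i).
  exact: leq_trans (ltnW ix) (grade_le4 x).
exists y => //; split=> //; rewrite lt_neqAle (flag_grade_le Af) ?ry ?(ltnW ix) // andbT.
by apply: contraTneq ix => <-; rewrite ry ltnn.
Qed.

Lemma graded_five A : is_flag A -> [/\ A \bot, A \top & A #= `I_5].
Proof.
move=> Af; split; [exact: flag_bot | exact: flag_top | ].
rewrite (_ : `I_5 = r @` A).
  apply/card_esym/inj_card_eq => y z; rewrite !inE => Ay Az.
  exact: (flag_grade_inj Af).
apply/seteqP; split=> [i /= i5|_ [y _ <-]]; last exact: grade_le4.
by have [y Ay ry] := flag_grade_onto Af i5; exists y.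
Qed.

(** The grading is therefore unique, and it is computed by the rank of the definitions,
whatever flag the latter picks. *)
Lemma rank_grade x : rank x = ((r x)%:Z - 1)%R.
Proof.
apply: xget_unique.
  have [|A Af xA] := @chain_extends _ _ [set x]; first by move=> ? ? -> ->; left.
  by exists A, (r x); split=> //; [apply: xA | apply: card_flag_below => //; apply: xA].
move=> _ [A [n [Af Ax An ->]]]; congr (_%:Z - 1)%R; apply/card_eq_II.
by apply: card_eq_trans (card_flag_below Af Ax); apply: card_esym.
Qed.
End Graded.

(** The shifted rank has values in nat, and so it indexes the elements of a flag from 0
(minimum) to 4 (maximum). *)
Definition rk d (T : tbPOrderType d) (x : T) : nat := absz (rank x + 1)%R.

Lemma rkE d (T : tbPOrderType d) (r : T -> nat) (x : T) : graded r -> rk x = r x.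
Proof. by move=> rg; rewrite /rk (rank_grade rg) subrK. Qed.

Lemma graded_rk d (T : tbPOrderType d) (r : T -> nat) : graded r -> graded (@rk d T).
Proof. by move=> rg; rewrite (_ : @rk d T = r) //; apply: funext => x; apply: rkE. Qed.

Lemma rank_rk d (T : tbPOrderType d) (x : T) :
  graded (@rk d T) -> rank x = ((rk x)%:Z - 1)%R.
Proof. by move=> g; rewrite [LHS](rank_grade g). Qed.

Lemma rank_eq d (T : tbPOrderType d) (x : T) (i : nat) :
  graded (@rk d T) -> rank x = (i%:Z)%R <-> rk x = i.+1.
Proof.
move=> g; rewrite rank_rk //; split=> [/eqP|->]; last by rewrite -addn1 PoszD addrK.
by rewrite subr_eq -PoszD addn1 => /eqP[].
Qed.

Lemma polyhedron_graded d (T : tbPOrderType d) : is_polyhedron T -> graded (@rk d T).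
Proof. by move=> /flags_have_5_elements/five_element_flags_graded[r]; apply: graded_rk. Qed.

(** * Flags and adjacency *)

Lemma card2P (T : eqType) (A : set T) (x : T) : A #= `I_2 -> A x ->
  exists2 y, y <> x & forall z, A z <-> z = x \/ z = y.
Proof.
move=> /eq_cardSP[a Aa /eq_cardSP[b [Ab ba] A0]] Ax.
have {}A0 z : A z -> z = a \/ z = b.
  move: A0; rewrite II0 card_eq0 => /eqP A0 Az.
  have [->|/eqP za] := eqVneq z a; first by left.
  have [->|/eqP zb] := eqVneq z b; first by right.
  by suff: (A `\ a `\ b) z by rewrite A0.
have [xa|xb] := A0 _ Ax; [exists b|exists a]; subst => //.
- by move=> z; split=> [/A0//|[]->].
- by move=> e; apply: ba.
- by move=> z; split=> [/A0[]->|[]->]; [right|left| |].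
Qed.

Lemma card_pair (T : eqType) (x y : T) (A : set T) : x <> y ->
  (forall z, A z <-> z = x \/ z = y) -> A #= `I_2.
Proof.
move=> /eqP xy Axy; rewrite (_ : A = [set` [:: x; y]]).
  by apply: card_seq; rewrite /= inE xy.
apply/seteqP; split=> z /=; rewrite !inE.
  by move=> /Axy[]->; rewrite eqxx ?orbT.
by move=> /orP[]/eqP-> ; apply/Axy; [left|right].
Qed.

Definition flag_mem d (T : tbPOrderType d) (Psi : flag T) : T -> Prop := flag_set Psi.
Coercion flag_mem : flag >-> Funclass.

Section Flags.
Context {d : Order.disp_t} {T : tbPOrderType d}.
Hypothesis gr : graded (@rk d T).
Implicit Types (x y z : T) (Psi : flag T) (i j : nat).

Lemma rk0 : rk (\bot : T) = 0%N. Proof. by case: gr. Qed.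
Lemma rk4 : rk (\top : T) = 4%N. Proof. by case: gr. Qed.
Lemma rk_lt x y : x < y -> (rk x < rk y)%N. Proof. by case: gr => _ _ + _; apply. Qed.
Lemma rk_le x y : x <= y -> (rk x <= rk y)%N.
Proof. by rewrite le_eqVlt => /predU1P[->//|/rk_lt/ltnW]. Qed.
Lemma rk_le4 x : (rk x <= 4)%N. Proof. exact: grade_le4. Qed.

Lemma rk0_eq x : rk x = 0%N -> x = \bot.
Proof.
move=> x0; have := le0x x; rewrite le_eqVlt => /predU1P[<-//|/rk_lt].
by rewrite x0 ltn0.
Qed.

Lemma rk4_eq x : rk x = 4%N -> x = \top.
Proof.
move=> x4; have := lex1 x; rewrite le_eqVlt => /predU1P[->//|/rk_lt].
by rewrite x4 rk4.
Qed.

Lemma incident_lt x y : (rk x < rk y)%N -> incident x y = (x < y).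
Proof.
rewrite /incident /Order.comparable lt_neqAle => rxy.
have -> : (y <= x) = false by apply: contraTF rxy => /rk_le; rewrite leqNgt.
by rewrite orbF; case: eqVneq rxy => [->|//]; rewrite ltnn.
Qed.

Lemma between_rk x y z : rk y = (rk x).+2 -> x < z -> z < y -> rk z = (rk x).+1.
Proof. by move=> e /rk_lt xz /rk_lt zy; apply/eqP; rewrite eqn_leq xz -ltnS -e zy. Qed.

(** The index is the shifted rank: el Psi 0 and el Psi 4 are the minimum and the maximum,
and the face of rank k is el Psi k.+1. *)
Definition el Psi i : T := xget \bot [set x | Psi x /\ rk x = i].

Lemma elP Psi i : (i <= 4)%N -> Psi (el Psi i) /\ rk (el Psi i) = i.
Proof.
move=> i4; have [x Px rx] := flag_grade_onto gr (flagP Psi) i4.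
exact: (@xgetI _ _ [set x | Psi x /\ rk x = i] x).
Qed.

Lemma rk_el Psi i : (i <= 4)%N -> rk (el Psi i) = i. Proof. by case/(elP Psi). Qed.
Lemma mem_el Psi i : (i <= 4)%N -> Psi (el Psi i). Proof. by case/(elP Psi). Qed.

Lemma el_mem Psi x : Psi x -> el Psi (rk x) = x.
Proof.
move=> Px; have [Pe re] := elP Psi (rk_le4 x).
exact: (flag_grade_inj gr (flagP Psi)).
Qed.

Lemma el0 Psi : el Psi 0 = \bot. Proof. exact: rk0_eq (rk_el _ _). Qed.
Lemma el4 Psi : el Psi 4 = \top. Proof. exact: rk4_eq (rk_el _ _). Qed.

Lemma el_lt Psi i j : (j <= 4)%N -> (i < j)%N -> el Psi i < el Psi j.
Proof.
move=> j4 ij; have i4 := ltnW (leq_trans ij j4).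
rewrite lt_neqAle (flag_grade_le gr (flagP Psi)) ?rk_el ?(ltnW ij) //; try exact: mem_el.
by rewrite andbT; apply/eqP => /(congr1 (@rk _ _)); rewrite !rk_el // => e; rewrite e ltnn in ij.
Qed.

Lemma el_le Psi i j : (j <= 4)%N -> (i <= j)%N -> el Psi i <= el Psi j.
Proof. by move=> j4; rewrite leq_eqVlt => /predU1P[->//|/(el_lt Psi j4)/ltW]. Qed.

Lemma flag_inj Psi Psi' : flag_set Psi = flag_set Psi' -> Psi = Psi'.
Proof. by case: Psi Psi' => [A Af] [B Bf] /= AB; subst B; congr Flag; apply: Prop_irrelevance.
  Qed.

Lemma el_inj Psi Psi' : (forall i : 'I_3, el Psi i.+1 = el Psi' i.+1) -> Psi = Psi'.
Proof.
move=> e; have {}e i : (i <= 4)%N -> el Psi i = el Psi' i.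
  case: i => [|i]; first by rewrite !el0.
  by rewrite ltnS leq_eqVlt => /predU1P[->|i3]; [rewrite !el4 | apply: (e (Ordinal i3))].
apply: flag_inj; apply/seteqP; split=> x Px; have r4 := rk_le4 x.
  by rewrite -(el_mem Px) e //; apply: mem_el.
by rewrite -(el_mem Px) -e //; apply: mem_el.
Qed.

Lemma chain_flag (C : set T) : chain C -> exists Psi, C `<=` Psi.
Proof. by move=> /chain_extends[A Af CA]; exists (Flag Af). Qed.

Lemma le_flag x y : x <= y -> exists Psi, Psi x /\ Psi y.
Proof.
move=> /chain2/chain_flag[Psi h]; exists Psi; split; apply: h; [by left|by right].
Qed.

Lemma sorted_flag s : sorted <=%O s -> exists Psi, forall x, x \in s -> Psi x.
Proof. by move=> /chain_seq/chain_flag[Psi sP]; exists Psi => x; apply: sP. Qed.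

Lemma adjacentE (k : 'I_3) Psi Psi' : adjacent k Psi Psi' <->
  Psi' <> Psi /\ forall j : 'I_3, j != k -> el Psi' j.+1 = el Psi j.+1.
Proof.
split=> -[neq e]; split=> //.
  move=> j jk; have j4 : (j.+1 <= 4)%N by exact: ltnW (ltn_ord j).
  have /e : rank (el Psi j.+1) <> (k%:Z)%R.
    by move/(rank_eq _ _ gr); rewrite rk_el // => -[/val_inj jk']; rewrite jk' eqxx in jk.
  by case=> _ /(_ (mem_el _ j4))/el_mem; rewrite rk_el.
have {}e i : (i <= 4)%N -> i != k.+1 -> el Psi i = el Psi' i.
  case: i => [|i]; first by rewrite !el0.
  rewrite ltnS leq_eqVlt => /predU1P[->|i3]; first by rewrite !el4.
  by rewrite eqSS => ik; rewrite (e (Ordinal i3)).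
move=> x rx; have {}rx : rk x != k.+1 by apply/eqP => /(rank_eq _ _ gr).
have r4 := rk_le4 x; have ee := e _ r4 rx.
by split=> /el_mem ex; rewrite -ex (ee, esym ee); apply: mem_el.
Qed.

(** The three axioms on the vertices and faces of an edge and on the edges between a vertex
and a face are the cases k = 0, 2 and 1. The minimum and the maximum serve as the missing
bounds in the first two. *)
Definition diamond := forall Psi (k : 'I_3), exists2 y,
  y <> el Psi k.+1 & forall z, (el Psi k < z < el Psi k.+2) <-> (z = el Psi k.+1 \/ z = y).

Hypothesis dia : diamond.

Lemma ord3_cases (P : 'I_3 -> Prop) :
  P o0 -> P o1 -> P o2 -> forall k : 'I_3, P k.
Proof. by move=> P0 P1 P2 [[|[|[|//]]] Hi]; rewrite (bool_irrelevance Hi isT). Qed.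

(** Exchanging one element of a flag for another one between its neighbours gives a chain
that meets all ranks, so a flag. *)
Lemma replace_flag Psi (k : 'I_3) y : el Psi k < y -> y < el Psi k.+2 ->
  exists2 Psi', el Psi' k.+1 = y & forall j : 'I_3, j != k -> el Psi' j.+1 = el Psi j.+1.
Proof.
move=> ky yk; have k4 : (k.+2 <= 4)%N by exact: ltn_ord k.
have k4' := ltnW k4; have k4'' := ltnW k4'.
have ry : rk y = k.+1 by rewrite (@between_rk (el Psi k) (el Psi k.+2)) ?rk_el.
have [|Psi' mem] := @chain_flag [set x | x = y \/ (Psi x /\ rk x <> k.+1)].
  have cmp x : Psi x -> rk x <> k.+1 -> x <= y \/ y <= x.
    move=> Px /eqP; rewrite neq_ltn ltnS => /orP[xk|kx]; [left|right].
      by rewrite (le_trans _ (ltW ky)) // -(el_mem Px) el_le.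
    by rewrite (le_trans (ltW yk)) // -(el_mem Px) el_le ?rk_le4.
  move=> u v [->|[Pu ru]] [->|[Pv rv]]; [by left| | exact: cmp | exact: (flagP Psi).1].
  by case: (cmp _ Pv rv); [right|left].
exists Psi'; first by rewrite -ry; apply/el_mem/mem; left.
move=> j jk; have j4 : (j.+1 <= 4)%N by exact: ltnW (ltn_ord j).
rewrite -[in LHS](rk_el Psi j4) el_mem //; apply: mem; right.
by split; [apply: mem_el | rewrite rk_el // => -[/val_inj e]; rewrite e eqxx in jk].
Qed.

Lemma el_between Psi Psi' (k : 'I_3) :
  (forall j : 'I_3, j != k -> el Psi' j.+1 = el Psi j.+1) ->
  el Psi k < el Psi' k.+1 < el Psi k.+2.
Proof.
move=> e; have k4 : (k.+2 <= 4)%N by exact: ltn_ord k.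
have {}e i : (i <= 4)%N -> i != k.+1 -> el Psi i = el Psi' i.
  case: i => [|i]; first by rewrite !el0.
  rewrite ltnS leq_eqVlt => /predU1P[->|i3]; first by rewrite !el4.
  by rewrite eqSS => ik; rewrite (e (Ordinal i3)).
by rewrite !e ?el_lt //; lia.
Qed.

Lemma adjacent_ex Psi (k : 'I_3) : exists Psi', adjacent k Psi Psi' /\
  forall Psi'', adjacent k Psi Psi'' -> Psi'' = Psi'.
Proof.
have [y yP zP] := dia Psi k; have /andP[ky yk] := (zP y).2 (or_intror erefl).
have [Psi' ey ej] := replace_flag ky yk; exists Psi'; split.
  by apply/adjacentE; split=> // e; apply: yP; rewrite -ey e.
move=> Psi'' /adjacentE[neq e]; apply: el_inj => j.
have [->|jk] := eqVneq j k; last by rewrite e // ej.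
have /zP[e1|->//] := el_between e.
case: neq; apply: el_inj => i; have [->//|ik] := eqVneq i k; exact: e.
Qed.

Implicit Type k : 'I_3.

Lemma adjP k Psi : adjacent k Psi (adj k Psi).
Proof. by have [Psi' [a _]] := adjacent_ex Psi k; apply: xgetI a. Qed.

Lemma adj_uniq k Psi Psi' : adjacent k Psi Psi' -> adj k Psi = Psi'.
Proof.
move=> a; have [Psi'' [_ u]] := adjacent_ex Psi k.
by rewrite (u _ a); apply/u/adjP.
Qed.

Lemma el_adj k (j : 'I_3) Psi : j != k -> el (adj k Psi) j.+1 = el Psi j.+1.
Proof. by have /adjacentE[_] := adjP k Psi; apply. Qed.

Lemma adjK k : involutive (adj k : flag T -> flag T).
Proof.
move=> Psi; have /adjacentE[neq e] := adjP k Psi.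
by apply: adj_uniq; apply/adjacentE; split=> [/esym//|j jk]; rewrite e.
Qed.

Lemma agree_adj k Psi Psi' : (forall j : 'I_3, j != k -> el Psi' j.+1 = el Psi j.+1) ->
  Psi' = Psi \/ Psi' = adj k Psi.
Proof.
move=> e; have [->|/eqP neq] := eqVneq Psi' Psi; [by left|right].
by apply/esym/adj_uniq/adjacentE.
Qed.

(** The letters are involutions on flags, so a letter and its inverse act in the same
way. *)
Definition walk Psi (w : word 'I_3) := foldl (fun F l => adj l.1 F) Psi w.

Lemma walk_cat Psi w w' : walk Psi (w ++ w') = walk (walk Psi w) w'.
Proof. exact: foldl_cat. Qed.

Lemma walk_rev Psi w : walk (walk Psi w) (rev w) = Psi.
Proof.
elim: w Psi => //= l w IH Psi.
by rewrite rev_cons -cats1 walk_cat IH /= adjK.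
Qed.

Lemma walk_rev_id Psi w : walk Psi (rev w) = Psi <-> walk Psi w = Psi.
Proof.
split=> e; last by rewrite -[in LHS]e walk_rev.
by rewrite -[in LHS]e -{2}[w]revK walk_rev.
Qed.

Lemma el_walk (k : 'I_3) Psi w : all (fun l => l.1 != k) w -> el (walk Psi w) k.+1 = el Psi k.+1.
Proof.
elim: w Psi => //= l w IH Psi /andP[lk wk].
by rewrite IH // el_adj // eq_sym.
Qed.

Definition conn (L : pred 'I_3) Psi Psi' :=
  exists2 w : word 'I_3, all (fun l => L l.1) w & walk Psi w = Psi'.

Lemma conn_refl L Psi : conn L Psi Psi. Proof. by exists [::]. Qed.
Lemma conn_trans L Psi1 Psi2 Psi3 : conn L Psi1 Psi2 -> conn L Psi2 Psi3 -> conn L Psi1 Psi3.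
Proof. by move=> [w Lw <-] [v Lv <-]; exists (w ++ v); rewrite ?all_cat ?Lw ?walk_cat. Qed.

Lemma conn_sub (L L' : pred 'I_3) Psi Psi' : (forall k, L k -> L' k) -> conn L Psi Psi' -> conn
  L' Psi Psi'.
Proof. by move=> LL' [w Lw <-]; exists w => //; apply: sub_all Lw => l; apply: LL'. Qed.

Lemma conn_agree (L : pred 'I_3) k Psi Psi' : L k ->
  (forall j : 'I_3, j != k -> el Psi' j.+1 = el Psi j.+1) -> conn L Psi Psi'.
Proof.
move=> Lk /agree_adj[->|->]; first exact: conn_refl.
by exists [:: (k, false)]; rewrite /= ?Lk.
Qed.

(** The form of strong connectedness that is used later: all flags are joined by walks,
and two flags with the same face of rank k by a walk that never changes that face. *)
Definition flag_connected := forall Psi Psi',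
  conn predT Psi Psi' /\ forall k, el Psi k.+1 = el Psi' k.+1 -> conn (predC1 k) Psi Psi'.

(** Follow a path of incident proper faces of G/F, passing from one flag to the next
through a flag that contains two consecutive faces of the path. *)
Lemma conn_section L (F G : T) :
  F <= G -> ((rk F).+2 < rk G)%N ->
  (forall F G : T, F <= G -> connected_section F G) ->
  (forall x Psi Psi', in_section F G x -> Psi F -> Psi G -> Psi x ->
     Psi' F -> Psi' G -> Psi' x -> conn L Psi Psi') ->
  forall Psi Psi', Psi F -> Psi G -> Psi' F -> Psi' G -> conn L Psi Psi'.
Proof.
move=> FG rFG strong Hx Psi Psi' PF PG P'F P'G.
have conn_xy : forall x y, in_section F G x -> in_section F G y ->
    exists s, [/\ path (@incident _ T) x s, all (in_section F G) s & last x s = y].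
  by case: (strong F G FG) => //; rewrite !rank_rk //; lia.
have rF3 : ((rk F).+3 <= 4)%N by rewrite (leq_trans rFG) ?rk_le4.
have xS (Q : flag T) : Q F -> Q G -> in_section F G (el Q (rk F).+1).
  move=> QF QG; apply/andP; split.
    by rewrite -[ltLHS](el_mem QF) el_lt //; lia.
  by rewrite -[ltRHS](el_mem QG) el_lt ?rk_le4 //; lia.
have [s [ps Ss lx]] := conn_xy _ _ (xS _ PF PG) (xS _ P'F P'G).
have Px : Psi (el Psi (rk F).+1) by apply: mem_el; lia.
have P'y : Psi' (last (el Psi (rk F).+1) s) by rewrite lx; apply: mem_el; lia.
move: (xS _ PF PG) ps Ss P'y Px {lx}; move: (el Psi _) => z.
elim: s z Psi PF PG => [|u s IH] z Psi PF PG zS /=.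
  by move=> _ _ P'z Pz; apply: (Hx z).
move=> /andP[zu us] /andP[uS sS] P'u Pz.
have /andP[Fz zG] := zS; have /andP[Fu uG] := uS.
have [Q QP] : exists Q : flag T, forall x, x \in [:: F; z; u; G] -> Q x.
  case/orP: zu => [zu|uz].
    by apply: sorted_flag; rewrite /= !(ltW Fz, zu, ltW uG).
  have [|Q QP] := @sorted_flag [:: F; u; z; G]; first by rewrite /= !(ltW Fu, uz, ltW zG).
  by exists Q => a aI; apply: QP; move: aI; rewrite !inE; do ![case: (a == _) => //=].
have QF : Q F by apply: QP; rewrite !inE eqxx.
have QG : Q G by apply: QP; rewrite !inE eqxx !orbT.
have Qz : Q z by apply: QP; rewrite !inE eqxx !orbT.
have Qu : Q u by apply: QP; rewrite !inE eqxx !orbT.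
by apply: (@conn_trans _ _ Q); [apply: (Hx z) | apply: (IH u)].
Qed.

(** For a vertex or a 2-face, flags through it and through a further face differ in one
element only, so that [conn_section] applies to the section above the vertex or below the
face; an edge needs no connectedness. Then [conn_section] applies to the whole poset. *)
Lemma strong_flag_connected :
  (forall F G : T, F <= G -> connected_section F G) -> flag_connected.
Proof.
move=> strong.
have agree_mem k Psi Psi' : el Psi k.+1 = el Psi' k.+1 <-> Psi' (el Psi k.+1).
  have k4 : (k.+1 <= 4)%N by exact: ltnW (ltn_ord k).
  split=> [->|/el_mem]; first exact: mem_el.
  by rewrite rk_el.
have same x Psi Psi' : Psi x -> Psi' x -> el Psi (rk x) = el Psi' (rk x).
  by move=> /el_mem-> /el_mem->.
have bot Psi : Psi \bot by rewrite -(el0 Psi); apply: mem_el.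
have top Psi : Psi \top by rewrite -(el4 Psi); apply: mem_el.
have face k Psi Psi' : el Psi k.+1 = el Psi' k.+1 -> conn (predC1 k) Psi Psi'.
  elim/ord3_cases: k => e.
  - have v : Psi' (el Psi 1) by rewrite e; apply: mem_el.
    apply: (@conn_section _ (el Psi 1) \top) => //; rewrite ?lex1 ?rk_el ?rk4 //;
      try exact: mem_el.
    move=> x Q Q' /andP[/rk_lt]; rewrite rk_el // => x1 /rk_lt; rewrite rk4 => x4.
    move=> Qv _ Qx Q'v _ Q'x; have := same _ _ _ Qv Q'v; rewrite rk_el // => e1.
    have := same _ _ _ Qx Q'x.
    have [e2|e2] : rk x = 2%N \/ rk x = 3%N by lia.
      rewrite e2 => e3; apply: (@conn_agree _ o2) => //.
      by elim/ord3_cases.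
    rewrite e2 => e3; apply: (@conn_agree _ o1) => //.
    by elim/ord3_cases.
  - have [||Q Qv Qe] := @replace_flag Psi o0 (el Psi' 1).
    + by rewrite /= el0 -(el0 Psi') el_lt.
    + by rewrite /= e el_lt.
    apply: (@conn_trans _ _ Q).
      by apply: (@conn_agree _ o0).
    apply: (@conn_agree _ o2) => //; elim/ord3_cases => //= _.
    by rewrite -e (Qe o1).
  - have v : Psi' (el Psi 3) by rewrite e; apply: mem_el.
    apply: (@conn_section _ \bot (el Psi 3)) => //; rewrite ?le0x ?rk_el ?rk0 //;
      try exact: mem_el.
    move=> x Q Q' /andP[/rk_lt]; rewrite rk0 => x1 /rk_lt; rewrite rk_el // => x4.
    move=> _ Qv Qx _ Q'v Q'x; have := same _ _ _ Qv Q'v; rewrite rk_el // => e1.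
    have := same _ _ _ Qx Q'x.
    have [e2|e2] : rk x = 2%N \/ rk x = 1%N by lia.
      rewrite e2 => e3; apply: (@conn_agree _ o0) => //.
      by elim/ord3_cases.
    rewrite e2 => e3; apply: (@conn_agree _ o1) => //.
    by elim/ord3_cases.
move=> Psi Psi'; split; last by move=> k; apply: face.
apply: (@conn_section _ \bot \top) => //; rewrite ?le0x ?rk0 ?rk4 //.
move=> x Q Q' /andP[/rk_lt + /rk_lt]; rewrite rk0 rk4 => x0 x4 _ _ Qx _ _ Q'x.
have x3 : ((rk x).-1 < 3)%N by lia.
apply: (@conn_sub (predC1 (Ordinal x3))) => //; apply: face => /=.
by rewrite prednK //; apply: same.
Qed.
End Flags.

Lemma polyhedron_diamond d (T : tbPOrderType d) : is_polyhedron T -> @diamond d T.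
Proof.
move=> pT; have gr := polyhedron_graded pT.
have rkq x (i : nat) : rank x = (i%:Z)%R <-> rk x = i.+1 := rank_eq x i gr.
move=> Psi; elim/ord3_cases => /=.
- have [||y y1 yP] := card2P (x := el Psi 1) (edge_two_vertices pT (e := el Psi 2) _).
  + by apply/(rkq _ 1%N); rewrite rk_el.
  + split; first by apply/(rkq _ 0%N); rewrite rk_el.
    by rewrite incident_lt ?rk_el ?el_lt.
  exists y => // z; rewrite -yP; split=> [/andP[z0 z2]|[/(rkq _ 0%N) rz]].
    have rz := between_rk gr _ z0 z2; rewrite !rk_el // in rz.
    split; first by apply/(rkq _ 0%N); rewrite rz.
    by rewrite incident_lt ?rz ?rk_el.
  rewrite incident_lt ?rz ?rk_el // => ->; rewrite andbT el0 // lt_neqAle le0x andbT.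
  by apply/eqP => e; move: rz; rewrite -e rk0.
- have [||||y y1 yP] := card2P (x := el Psi 2) (vertex_face_two_edges pT (v := el Psi 1) (f :=
  el Psi 3) _ _ _).
  + by apply/(rkq _ 0%N); rewrite rk_el.
  + by apply/(rkq _ 2%N); rewrite rk_el.
  + by rewrite incident_lt ?rk_el ?el_lt.
  + split; first by apply/(rkq _ 1%N); rewrite rk_el.
      by rewrite incident_lt ?rk_el ?el_lt.
    by rewrite incident_lt ?rk_el ?el_lt.
  exists y => // z; rewrite -yP; split=> [/andP[z0 z2]|[/(rkq _ 1%N) rz]].
    have rz := between_rk gr _ z0 z2; rewrite !rk_el // in rz.
    split; first by apply/(rkq _ 1%N); rewrite rz // rk_el.
      by rewrite incident_lt ?rz ?rk_el.
    by rewrite incident_lt ?rz ?rk_el.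
  by rewrite !incident_lt ?rz ?rk_el // => -> ->.
- have [||y y1 yP] := card2P (x := el Psi 3) (edge_two_faces pT (e := el Psi 2) _).
  + by apply/(rkq _ 1%N); rewrite rk_el.
  + split; first by apply/(rkq _ 2%N); rewrite rk_el.
    by rewrite incident_lt ?rk_el ?el_lt.
  exists y => // z; rewrite -yP; split=> [/andP[z0 z2]|[/(rkq _ 2%N) rz]].
    have rz := between_rk gr _ z0 z2; rewrite !rk_el // in rz.
    split; first by apply/(rkq _ 2%N); rewrite rz // rk_el.
    by rewrite incident_lt ?rz ?rk_el.
  rewrite incident_lt ?rz ?rk_el // => ->; rewrite el4 // lt_neqAle lex1 andbT.
  by apply/eqP => e; move: rz; rewrite e rk4.
Qed.

Lemma polyhedron_connected d (T : tbPOrderType d) : is_polyhedron T -> @flag_connected d T.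
Proof.
move=> pT; apply: strong_flag_connected; last exact: strongly_connected.
- exact: polyhedron_graded.
- exact: polyhedron_diamond.
Qed.

(** * Maps of polyhedra determined by walks *)

Section Polyhedron.
Context {d : Order.disp_t} {P : tbPOrderType d}.
Hypothesis pP : is_polyhedron P.

Lemma walk_to (Phi Psi : flag P) : exists w, walk Phi w = Psi.
Proof. by have [[w _ <-] _] := polyhedron_connected pP Phi Psi; exists w. Qed.

Lemma walk_onto (Phi : flag P) x y : x <= y ->
  exists w, (walk Phi w : flag P) x /\ (walk Phi w : flag P) y.
Proof. by move=> /le_flag[Psi ?]; have [w e] := walk_to Phi Psi; exists w; rewrite e. Qed.
End Polyhedron.

Section CoverMap.
Context {dP dR : Order.disp_t} {P : tbPOrderType dP} {R : tbPOrderType dR}.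
Hypotheses (pP : is_polyhedron P) (pR : is_polyhedron R).
Variables (Phi : flag P) (Psi : flag R).
Hypothesis stab : forall w, walk Phi w = Phi -> walk Psi w = Psi.

Let grP := polyhedron_graded pP.
Let grR := polyhedron_graded pR.
Let diaP := polyhedron_diamond pP.
Let diaR := polyhedron_diamond pR.

Lemma stab_eq w w' : walk Phi w = walk Phi w' -> walk Psi w = walk Psi w'.
Proof.
move=> e; have /stab : walk Phi (w ++ rev w') = Phi by rewrite walk_cat e walk_rev.
rewrite walk_cat => /(congr1 (fun F => walk F w')) <-.
by rewrite -{2}[w']revK walk_rev.
Qed.

(** Two flags with the same face of rank i differ by a walk without the letter i. The
corresponding walk in R does not change the face of rank i either. *)
Lemma stab_el w w' i : (i <= 4)%N -> el (walk Phi w) i = el (walk Phi w') i ->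
  el (walk Psi w) i = el (walk Psi w') i.
Proof.
case: i => [|i]; first by rewrite !el0.
rewrite ltnS leq_eqVlt => /predU1P[->|i3]; first by rewrite !el4.
move=> e; have [_ /(_ (Ordinal i3) e)[v vi ev]] := polyhedron_connected pP (walk Phi w) (walk
  Phi w').
have /stab_eq<- : walk Phi (w ++ v) = walk Phi w' by rewrite walk_cat.
by rewrite walk_cat [RHS](el_walk grR diaR (k := Ordinal i3)).
Qed.

(** A face is sent to the face of the same rank in the flag of R reached by the same walk,
which by [stab_el] does not depend on the walk. *)
Lemma cover_map : exists f : P -> R,
  forall w i, (i <= 4)%N -> f (el (walk Phi w) i) = el (walk Psi w) i.
Proof.
have /choice[f fP] : forall x, exists y, forall w, (walk Phi w : flag P) x -> el (walk Psi w)
  (rk x) = y.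
  move=> x; have [w [wx _]] := walk_onto pP Phi (lexx x).
  exists (el (walk Psi w) (rk x)) => v vx; apply: stab_el; first exact: rk_le4.
  by rewrite !el_mem.
by exists f => w i i4; rewrite -(fP _ w) ?rk_el //; apply: mem_el.
Qed.
End CoverMap.

(** Both maps of [cover_map] exist, and they are inverse to each other: each sends the
faces of the flag reached by a word to those of the flag reached by the same word. *)
Lemma iso_of_walks dP dR (P : tbPOrderType dP) (R : tbPOrderType dR)
    (Phi : flag P) (Psi : flag R) :
  is_polyhedron P -> is_polyhedron R ->
  (forall w, walk Phi w = Phi <-> walk Psi w = Psi) ->
  exists f g, [/\ cancel f g, cancel g f, {mono f : x y / x <= y} &
    forall i, (i <= 4)%N -> f (el Phi i) = el Psi i].
Proof.
move=> pP pR stab; have grP := polyhedron_graded pP; have grR := polyhedron_graded pR.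
have [f fP] := cover_map pP pR (fun w => (stab w).1).
have [g gP] := cover_map pR pP (fun w => (stab w).2).
have fK : cancel f g.
  move=> x; have [w [wx _]] := walk_onto pP Phi (lexx x).
  by rewrite -(el_mem grP wx) fP ?gP ?rk_le4.
have gK : cancel g f.
  move=> x; have [w [wx _]] := walk_onto pR Psi (lexx x).
  by rewrite -(el_mem grR wx) gP ?fP ?rk_le4.
exists f, g; split=> //; last by move=> i i4; rewrite -(fP [::]).
move=> x y; apply/idP/idP => [|xy].
  rewrite -{2}[x]fK -{2}[y]fK; move: (f x) (f y) => u v uv.
  have [w [wu wv]] := walk_onto pR Psi uv.
  by rewrite -(el_mem grR wu) -(el_mem grR wv) !gP ?el_le ?rk_le ?rk_le4.
have [w [wx wy]] := walk_onto pP Phi xy.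
by rewrite -(el_mem grP wx) -(el_mem grP wy) !fP ?el_le ?rk_le ?rk_le4.
Qed.

Section Isomorphism.
Context {dP dR : Order.disp_t} {P : tbPOrderType dP} {R : tbPOrderType dR}.
Variables (f : P -> R) (g : R -> P).
Hypotheses (fK : cancel f g) (gK : cancel g f) (fM : {mono f : x y / x <= y}).
Hypotheses (grP : graded (@rk _ P)) (grR : graded (@rk _ R)).
Hypotheses (diaP : @diamond _ P) (diaR : @diamond _ R).

Let gM : {mono g : x y / x <= y}. Proof. by move=> x y; rewrite -fM !gK. Qed.
Let f_lt : {mono f : x y / x < y}.
Proof. by move=> x y; rewrite !lt_neqAle fM (can_eq fK). Qed.

(** An isomorphism transports the grading, and gradings are unique. *)
Lemma iso_rk x : rk (f x) = rk x.
Proof.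
apply/esym; rewrite (rkE (r := @rk _ R \o f)) //; split=> [|||x' y'] /=.
- suff -> : f \bot = \bot by exact: rk0.
  by apply/le_anti; rewrite le0x andbT -[\bot in leRHS]gK fM le0x.
- suff -> : f \top = \top by exact: rk4.
  by apply/le_anti; rewrite lex1 /= -[\top in leLHS]gK fM lex1.
- by move=> y z yz; apply: rk_lt => //; rewrite f_lt.
- move=> xy; case: (grR) => _ _ _ /(_ (f x') (f y')); rewrite f_lt => /(_ xy) h /h[z].
  by rewrite -[z]gK !f_lt => ? ?; exists (g z).
Qed.

Lemma iso_flag (Psi : flag P) : is_flag (f @` Psi).
Proof.
split=> [_ _ [x Px <-] [y Py <-]|B Bc sB].
  by rewrite !fM; apply: (flagP Psi).1.
have PB : g @` B = flag_set Psi.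
  apply: (flagP Psi).2 => [_ _ [x Bx <-] [y By <-]|x Px].
    by rewrite !gM; apply: Bc.
  by exists (f x); rewrite ?fK //; apply: sB; exists x.
apply/seteqP; split=> // y By; exists (g y) => //.
by rewrite -[flag_set Psi]PB; exists y.
Qed.

Definition image_flag (Psi : flag P) : flag R := Flag (iso_flag Psi).

Lemma el_image Psi i : (i <= 4)%N -> el (image_flag Psi) i = f (el Psi i).
Proof.
move=> i4; rewrite -[in LHS](rk_el grP Psi i4) -iso_rk el_mem //.
by exists (el Psi i) => //; apply: mem_el.
Qed.

Lemma image_adj k Psi : image_flag (adj k Psi) = adj k (image_flag Psi).
Proof.
apply/esym/adj_uniq => //; apply/adjacentE => //; have /adjacentE[//|neq e] := adjP grP diaP k
  Psi.
split=> [E|j jk]; last by rewrite !el_image ?e //; exact: ltnW (ltn_ord j).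
apply: neq; apply: (el_inj grP) => i; have i4 : (i.+1 <= 4)%N := ltnW (ltn_ord i).
by apply: (can_inj fK); rewrite -!el_image // E.
Qed.

Lemma image_walk Psi w : image_flag (walk Psi w) = walk (image_flag Psi) w.
Proof. by elim: w Psi => //= l w IH Psi; rewrite IH image_adj. Qed.

Lemma image_flag_inj : injective image_flag.
Proof.
move=> Psi Psi' E; apply: (el_inj grP) => i; have i4 : (i.+1 <= 4)%N := ltnW (ltn_ord i).
by apply: (can_inj fK); rewrite -!el_image // E.
Qed.
End Isomorphism.

(** * Automorphisms of regular polyhedra and walks *)

Section Automorphisms.
Context {d : Order.disp_t} {P : tbPOrderType d}.
Hypothesis pP : is_polyhedron P.
Let gr := polyhedron_graded pP.
Let dia := polyhedron_diamond pP.
Implicit Types (g h : Aut P) (Psi : flag P).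

Lemma aut_mono g : {mono g : x y / x <= y}.
Proof. exact/asboolP/(autP g). Qed.

Definition act g Psi : flag P := image_flag (sym_funK g) (sym_invK g) (aut_mono g) Psi.

Lemma act_adj g k Psi : act g (adj k Psi) = adj k (act g Psi).
Proof. exact: image_adj. Qed.

Lemma act_walk g w Psi : act g (walk Psi w) = walk (act g Psi) w.
Proof. exact: image_walk. Qed.

Lemma el_act g Psi i : (i <= 4)%N -> el (act g Psi) i = g (el Psi i).
Proof. exact: el_image. Qed.

Lemma act1 Psi : act 1%g Psi = Psi.
Proof. by apply: (el_inj gr) => i; rewrite el_act ?val1 //; exact: ltnW (ltn_ord i). Qed.

Lemma actM g h Psi : act (g * h)%g Psi = act h (act g Psi).
Proof. by apply: (el_inj gr) => i; have i4 := ltnW (ltn_ord i); rewrite !el_act. Qed.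

(** An automorphism commutes with walks, and every face lies in a flag reached from
Psi. *)
Lemma act_free g h Psi : act g Psi = act h Psi -> g = h.
Proof.
move=> E; apply: val_inj; apply: symP => x /=.
have [w [wx _]] := walk_onto pP Psi (lexx x).
by rewrite -(el_mem gr wx) -!el_act ?rk_le4 // !act_walk E.
Qed.

Hypothesis rP : is_regular P.
Variable Phi : flag P.

Lemma regular_act Psi Psi' : exists g, act g Psi = Psi'.
Proof.
have [g gP] := rP.2 Psi Psi'; exists g; exact: flag_inj.
Qed.

Lemma act_rho k : act (rho Phi k) Phi = adj k Phi.
Proof.
apply: flag_inj; apply: (@xgetPex _ _ [set g : Aut P | g @` Phi = flag_set (adj k Phi)]).
exact: rP.2.
Qed.

Lemma act_rhoV k : act (rho Phi k)^-1%g Phi = adj k Phi.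
Proof.
have e : act (rho Phi k) (adj k Phi) = Phi by rewrite act_adj act_rho (adjK gr dia).
by rewrite -[X in act _ X = _]e -actM mulgV act1.
Qed.

(** Automorphisms commute with adjacency, so the letters of w are applied to the flag in
reverse order: the last letter of w acts first. *)
Lemma act_eval_rho w : act (eval (rho Phi) w) Phi = walk Phi (rev w).
Proof.
rewrite /eval; elim: w => [|[k e] w IH]; first by rewrite big_nil act1.
rewrite big_cons actM rev_cons -cats1 walk_cat /= -IH -act_adj.
by case: e => /=; rewrite (act_rho, act_rhoV).
Qed.

Lemma eval_rho_eq1 w : eval (rho Phi) w = 1%g <-> walk Phi w = Phi.
Proof.
rewrite -(walk_rev_id gr dia) -act_eval_rho; split=> [->|E]; first exact: act1.
by apply: (@act_free _ _ Phi); rewrite act1.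
Qed.

Lemma rho_generate g : exists w, eval (rho Phi) w = g.
Proof.
have [w e] := walk_to pP Phi (act g Phi); exists (rev w).
by apply: (@act_free _ _ Phi); rewrite act_eval_rho revK.
Qed.
End Automorphisms.

(** If a word that returns to some flag returns to all of them, then [iso_of_walks] gives
automorphisms between any two flags. *)
Lemma regular_of_walks d (P : tbPOrderType d) : is_polyhedron P ->
  (forall (Phi Psi : flag P) w, walk Phi w = Phi -> walk Psi w = Psi) -> is_regular P.
Proof.
move=> pP H; split=> // Phi Psi; have gr := polyhedron_graded pP.
have dia := polyhedron_diamond pP.
have [|f [g [fK gK fM fe]]] := iso_of_walks (Phi := Phi) (Psi := Psi) pP pP.
  by move=> w; split; apply: H.
have fA : is_automorphism (MkSym fK gK) by exact/asboolP.
exists (MkAut fA); suff /(congr1 (@flag_set _ _)) : image_flag fK gK fM Phi = Psi by [].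
by apply: (el_inj gr) => i; rewrite el_image ?fe //; exact: ltnW (ltn_ord i).
Qed.

Section Monodromy.
Context {d : Order.disp_t} {Q : tbPOrderType d}.
Hypotheses (gr : graded (@rk _ Q)) (dia : @diamond _ Q).

Lemma mon_genE k (Psi : flag Q) : mon_gen Q k Psi = adj k Psi.
Proof.
have K : cancel (adj k : flag Q -> flag Q) (adj k) by exact: adjK.
have := @xgetPex _ 1%g [set s : Sym (flag Q) | forall Psi, s Psi = adj k Psi].
by apply; exists (MkSym K K).
Qed.

Lemma eval_mon w (Psi : flag Q) : eval (mon_gen Q) w Psi = walk Psi w.
Proof.
rewrite /eval; elim: w Psi => [|[k e] w IH] Psi; first by rewrite big_nil.
rewrite big_cons /= IH; congr walk; case: e => /=; last exact: mon_genE.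
by apply: (can_inj (sym_funK (mon_gen Q k))); rewrite sym_invK mon_genE (adjK gr dia).
Qed.

Lemma in_mon_eval w : in_mon (eval (mon_gen Q) w).
Proof.
have [m1 mF] := mon_group_closed Q.
rewrite /eval; elim: w => [|[k e] w IH]; first by rewrite big_nil.
have gen : in_mon (mon_gen Q k) by apply/asboolP => S [_ SX]; apply: SX; exists k.
have mV (x : Sym (flag Q)) : in_mon x -> in_mon (x^-1)%g.
  by move=> xm; rewrite -[(x^-1)%g]mul1g; exact: (mF 1%g x m1 xm).
have {}mF (x y : Sym (flag Q)) : in_mon x -> in_mon y -> in_mon (x * y)%g.
  by move=> xm ym; rewrite -[y]invgK; exact: (mF x (y^-1)%g xm (mV y ym)).
by rewrite big_cons; apply: mF => //; case: e => //=; apply: mV.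
Qed.
End Monodromy.

(** The homomorphism sends an automorphism, written as a word in the distinguished
generators, to the action of this word on the flags of Q. It is well defined when
returning words act trivially. *)
Lemma covers_walks dP (P : tbPOrderType dP) (Phi : flag P) dQ (Q : tbPOrderType dQ) :
    is_regular P -> graded (@rk _ Q) -> @diamond _ Q ->
  covers Phi Q <-> forall w, walk Phi w = Phi -> forall Psi : flag Q, walk Psi w = Psi.
Proof.
move=> rP gr dia; have pP := rP.1; split=> [[f fP] w|H].
  have f1 : f 1%g = 1%g by apply: (mulgI (f 1%g)); rewrite -gmulfM !mulg1.
  have fV x : f (x^-1)%g = (f x)^-1%g.
    by apply: (mulgI (f x)); rewrite -gmulfM !mulgV.
  have vM (x y : Mon Q) : mon_perm (x * y)%g = (mon_perm x * mon_perm y)%g by exact: valM.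
  have v1 : mon_perm (1%g : Mon Q) = 1%g by exact: val1.
  have vV (x : Mon Q) : mon_perm (x^-1)%g = ((mon_perm x)^-1)%g.
    by apply: (mulgI (mon_perm x)); rewrite -vM !mulgV.
  have fE : mon_perm (f (eval (rho Phi) w)) = eval (mon_gen Q) w.
    rewrite /eval; elim: w => [|[k e] w IH]; first by rewrite !big_nil f1 v1.
    rewrite !big_cons gmulfM vM IH; congr (_ * _)%g.
    by case: e => /=; rewrite ?fV ?vV fP.
  move=> /(eval_rho_eq1 pP rP) e Psi; rewrite -(eval_mon gr dia) -fE e f1.
  by rewrite v1.
have /choice[wd wdP] := rho_generate pP rP Phi.
pose f (g : Aut P) : Mon Q := MkMon (in_mon_eval (wd g)).
have fE w g : eval (rho Phi) w = g -> mon_perm (f g) = eval (mon_gen Q) w.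
  move=> e; apply: symP => Psi; rewrite !(eval_mon gr dia).
  have {}e : walk Phi (rev (wd g)) = walk Phi (rev w).
    by rewrite -!(act_eval_rho pP rP) wdP e.
  have /H : walk Phi (rev (wd g) ++ w) = Phi.
    by rewrite walk_cat e -{2}[w]revK (walk_rev (polyhedron_graded pP) (polyhedron_diamond pP)).
  move=> /(_ (walk Psi (wd g))); rewrite walk_cat => <-.
  by rewrite (walk_rev gr dia).
have fM : {morph f : g h / (g * h)%g}.
  move=> g h; apply: val_inj; rewrite valM.
  change (mon_perm (f (g * h)%g) = (mon_perm (f g) * mon_perm (f h))%g).
  rewrite (fE (wd g ++ wd h)) 1?(fE (wd g) g) 1?(fE (wd h) h) //.
    by rewrite /eval big_cat.
  by rewrite /eval big_cat -!/(eval _ _) !wdP.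
exists (HB.pack_for {multiplicative Aut P -> Mon Q} f (isMultiplicative.Build _ _ f fM)).
move=> k; apply: etrans (fE [:: (k, false)] _ _) _; by rewrite /eval big_seq1.
Qed.

(** * The polyhedron of a group generated by three involutions *)

Section CosetPoset.
Import mathcomp.boot.finset.
Local Close Scope classical_set_scope.
Local Open Scope set_scope.
Local Open Scope group_scope.
Variables (gT : finGroupType) (x : 'I_3 -> gT).
Implicit Types (J K : {set 'I_3}) (u v : gT) (i j k : 'I_3).

Definition parab J : {group gT} := [group of <<x @: J>>].

Definition is_coset (A : {set gT}) : bool :=
  (A == set0) || [exists J, exists v in parab setT, A == v *: parab J].

(** For three involutions none of which lies in the group generated by the others, the
cosets are the faces of a map: the Cayley graph, with edges coloured by the generators,
together with its two-coloured cycles. The empty set is the minimum. *)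
Record coset_face := CosetFace { coset_set :> {set gT}; coset_setP : is_coset coset_set }.

HB.instance Definition _ := [isSub for coset_set].
HB.instance Definition _ := [Finite of coset_face by <:].

Definition coset_le (A B : coset_face) : bool := coset_set A \subset coset_set B.

Lemma coset_le_refl : reflexive coset_le.
Proof. by move=> A; apply: fintype.subxx. Qed.
Lemma coset_le_anti : antisymmetric coset_le.
Proof. by move=> A B AB; apply: val_inj; apply/eqP; rewrite eqEsubset. Qed.
Lemma coset_le_trans : transitive coset_le.
Proof. by move=> B A C; apply: fintype.subset_trans. Qed.

Fact coset_display : Order.disp_t. Proof. exact: (Order.Disp tt tt). Qed.

HB.instance Definition _ := Order.Le_isPOrder.Build coset_display coset_face
  coset_le_refl coset_le_anti coset_le_trans.

Lemma is_coset0 : is_coset set0. Proof. by rewrite /is_coset eqxx. Qed.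
Lemma is_coset_parab J v : v \in parab setT -> is_coset (v *: parab J).
Proof.
move=> vN; apply/orP; right; apply/existsP; exists J; apply/existsP; exists v.
by rewrite vN eqxx.
Qed.

Lemma parab_sub J K : J \subset K -> parab J \subset parab K.
Proof. by move=> JK; apply/genS/imsetS. Qed.

Lemma mem_parab J j : j \in J -> x j \in parab J.
Proof. by move=> jJ; apply/mem_gen/imset_f. Qed.

Lemma coset_faceP (A : coset_face) : coset_set A = set0 \/
  exists J v, v \in parab setT /\ coset_set A = v *: parab J.
Proof.
case: A => A /= /orP[/eqP|/existsP[J /existsP[v /andP[vN /eqP]]]]; first by left.
by right; exists J, v.
Qed.

Lemma coset_le0 (A : coset_face) : (CosetFace is_coset0 <= A)%O.
Proof. exact: sub0set. Qed.

Lemma coset_le1 (A : coset_face) : (A <= CosetFace (is_coset_parab setT (group1 _)))%O.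
Proof.
rewrite /Order.le /= /coset_le /= lcoset1.
have [->|[J [v [vN ->]]]] := coset_faceP A; first exact: sub0set.
rewrite -(lcoset_id vN); apply: mulgS; exact: parab_sub (subsetT _).
Qed.

HB.instance Definition _ := Order.hasBottom.Build coset_display coset_face coset_le0.
HB.instance Definition _ := Order.hasTop.Build coset_display coset_face coset_le1.

Lemma coset_leE (A B : coset_face) : (A <= B)%O = (coset_set A \subset coset_set B).
Proof. by []. Qed.

(** Inverses of generators need no case of their own, since each element of a finite group
is a product of generators. *)
Lemma gen_ind (S : {set gT}) (P : gT -> Prop) : P 1 ->
  (forall g s, P g -> s \in S -> P (g * s)) -> forall g, g \in <<S>> -> P g.
Proof.
move=> P1 PM g /gen_prodgP[n [c cS ->]]; elim: n c cS => [|n IH] c cS.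
  by rewrite big_ord0.
by rewrite big_ord_recr /=; apply: PM => //; apply: IH.
Qed.

Hypothesis xx : forall j, x j * x j = 1.
Hypothesis indep : forall J j, x j \in parab J -> j \in J.

Lemma parab1 J v u : u \in v *: parab J -> v *: parab J = u *: parab J.
Proof. by move=> uv; apply/lcoset_eqP; rewrite lcoset_sym. Qed.

(** By independence the set J can be read off a coset of W_J, and inclusion of cosets
amounts to inclusion of colour sets. *)
Lemma parab_subset J K u v : (u *: parab J \subset v *: parab K) =
  (J \subset K) && (u \in v *: parab K).
Proof.
apply/idP/andP => [sub|[JK uv]]; last by rewrite (parab1 uv) mulgS ?parab_sub.
have uv : u \in v *: parab K by apply: (fintype.subsetP sub); apply: lcoset_refl.
split=> //; apply/fintype.subsetP => j /mem_parab jJ; apply: indep.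
move: sub; rewrite (parab1 uv) => /fintype.subsetP/(_ (u * x j)).
by rewrite !mem_lcoset !mulKg; apply.
Qed.

Lemma coset_neq0 J v : v *: parab J != set0.
Proof. by apply/set0Pn; exists v; apply: lcoset_refl. Qed.

(** Recovers J from a coset of W_J: the colours of the edges between its elements. *)
Definition coset_type (A : {set gT}) : {set 'I_3} := [set j | [exists v in A, v * x j \in A]].

Lemma coset_type_parab J v : coset_type (v *: parab J) = J.
Proof.
apply/setP => j; rewrite inE; apply/existsP/idP => [[u /andP[uv]]|jJ].
  by rewrite (parab1 uv) mem_lcoset mulKg => /indep.
by exists v; rewrite !mem_lcoset mulVg group1 mulKg mem_parab.
Qed.

(** A total function of v, so that no proof that v belongs to the group occurs in
equations between faces; it has the intended value when v does. *)
Definition cface J v : coset_face := insubd (\bot%O : coset_face) (v *: parab J).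

Lemma cfaceE J v : v \in parab setT -> coset_set (cface J v) = v *: parab J.
Proof. by move=> vN; rewrite [LHS]insubdK //; apply: is_coset_parab. Qed.

Lemma cface_cases (A : coset_face) : A = \bot%O \/
  exists J v, v \in parab setT /\ A = cface J v.
Proof.
have [A0|[J [v [vN Av]]]] := coset_faceP A; first by left; apply: val_inj.
by right; exists J, v; split=> //; apply: val_inj => /=; rewrite [RHS]cfaceE.
Qed.

Lemma le_cface J K u v : u \in parab setT -> v \in parab setT ->
  (cface J u <= cface K v)%O = (J \subset K) && (u \in v *: parab K).
Proof. by move=> uN vN; rewrite coset_leE !cfaceE // parab_subset. Qed.

Lemma cface_eq J u v : v \in parab setT -> u \in v *: parab J -> cface J u = cface J v.
Proof.
move=> vN uv; have uN : u \in parab setT.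
  rewrite -[u](mulKVg v) groupM // (fintype.subsetP (parab_sub (subsetT J))) //.
  by rewrite -mem_lcoset.
by apply: val_inj; rewrite /= !cfaceE // (parab1 uv).
Qed.

Lemma cface_eqE J K u v : u \in parab setT -> v \in parab setT ->
  cface J u = cface K v -> J = K /\ u \in v *: parab K.
Proof.
move=> uN vN /(congr1 coset_set); rewrite !cfaceE // => E.
split; last by rewrite -E lcoset_refl.
by rewrite -(coset_type_parab J u) E coset_type_parab.
Qed.

Definition coset_rk (A : coset_face) : nat :=
  if coset_set A == set0 then 0 else #|coset_type A|.+1.

Lemma coset_rkE J v : v \in parab setT -> coset_rk (cface J v) = #|J|.+1.
Proof. by move=> vN; rewrite /coset_rk cfaceE // (negbTE (coset_neq0 _ _)) coset_type_parab. Qed.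

Lemma cface_top v : v \in parab setT -> cface setT v = \top%O.
Proof. by move=> vN; apply: val_inj; rewrite /= cfaceE // lcoset1 lcoset_id. Qed.

Lemma coset_graded : graded coset_rk.
Proof.
have rk0 : coset_rk \bot%O = 0 by rewrite /coset_rk eqxx.
have lt (A B : coset_face) : (A <= B)%O -> coset_rk A != coset_rk B -> (A < B)%O.
  by move=> AB rAB; rewrite lt_neqAle AB andbT; apply: contraNneq rAB => ->.
split=> //.
- by rewrite -(cface_top (group1 _)) coset_rkE // cardsT card_ord.
- move=> A B; have [->|[J [v [vN ->]]]] := cface_cases A.
    by have [->|[K [u [uN ->]]]] := cface_cases B; rewrite ?ltxx // rk0 coset_rkE.
  have [->|[K [u [uN ->]]]] := cface_cases B; first by rewrite ltx0.
  rewrite lt_neqAle le_cface // => /and3P[neq JK vu].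
  rewrite !coset_rkE // ltnS ltn_neqAle subset_leq_card // andbT.
  apply: contraNneq neq => eJK; have /eqP-> : J == K by rewrite eqEcard JK eJK leqnn.
  by rewrite (cface_eq _ vu).
move=> A B; have [->|[K [u [uN ->]]]] := cface_cases B; first by rewrite ltx0.
have [->|[J [v [vN ->]]]] := cface_cases A; rewrite ?rk0 ?coset_rkE //.
  move=> _ K0; exists (cface set0 u); apply: lt; rewrite ?le0x ?rk0 ?coset_rkE ?cards0 //.
    by rewrite le_cface // sub0set lcoset_refl.
  by move: K0; rewrite !ltnS lt0n eq_sym.
move=> /ltW; rewrite le_cface // => /andP[JK vu] JK2.
have [j] : exists j, j \in K :\: J.
  by apply/set0Pn; rewrite -card_gt0 cardsD (setIidPr JK) subn_gt0; apply: ltnW; rewrite -ltnS.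
rewrite inE => /andP[jJ jK]; exists (cface (j |: J) v); apply: lt;
  rewrite ?coset_rkE ?cardsU1 ?jJ ?le_cface ?lcoset_refl ?vu ?subsetUr ?andbT //.
- by rewrite neq_ltn; lia.
- by rewrite subUset sub1set jK.
- by rewrite neq_ltn; lia.
Qed.

Definition coset_gr := graded_rk coset_graded.
Let gr := coset_gr.

Lemma rk_cface J v : v \in parab setT -> rk (cface J v) = #|J|.+1.
Proof. by move=> vN; rewrite (rkE _ coset_graded) coset_rkE. Qed.

Lemma cface_of_rk (A : coset_face) m : rk A = m.+1 ->
  exists J v, [/\ v \in parab setT, A = cface J v & #|J| = m].
Proof.
have [->|[J [v [vN ->]]]] := cface_cases A; first by rewrite (rk0 gr).
by rewrite rk_cface // => -[]; exists J, v.
Qed.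

Lemma lt_cface J K u v : u \in parab setT -> v \in parab setT ->
  (cface J u < cface K v)%O = (J \proper K) && (u \in v *: parab K).
Proof.
move=> uN vN; apply/idP/andP => [lt|[/andP[JK KJ] uv]].
  have := ltW lt; rewrite le_cface // => /andP[JK uv]; split=> //.
  by rewrite properEcard JK; have := rk_lt gr lt; rewrite !rk_cface.
rewrite lt_neqAle le_cface // JK uv !andbT; apply/eqP => /cface_eqE[] // e.
by rewrite e subxx in KJ.
Qed.

Lemma bot_cface v J : v \in parab setT -> (\bot%O < cface J v)%O.
Proof.
move=> vN; rewrite lt_neqAle le0x andbT; apply/eqP => /(congr1 (@rk _ _)).
by rewrite rk_cface // (rk0 gr).
Qed.

Lemma parab_set0 : parab set0 = 1%G.
Proof. by apply: val_inj; rewrite /= imset0 gen0. Qed.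

Lemma parab_set1 j : parab [set j] = [set 1; x j] :> {set gT}.
Proof.
rewrite /= imset_set1; apply/setP => g; apply/idP/idP.
  move: g; apply: gen_ind => [|g s]; first by rewrite !inE eqxx.
  rewrite !inE => /orP[]/eqP-> /eqP->; first by rewrite mul1g eqxx orbT.
  by rewrite xx eqxx.
by rewrite !inE => /orP[]/eqP->; rewrite ?group1 ?mem_gen ?set11.
Qed.

(** Below a face, vertices are joined by paths that alternate vertices and edges; above a
vertex v, vW_i and vW_j are joined through vW_ij. Other sections have rank at most 1. *)
Lemma coset_strong (F G : coset_face) : (F <= G)%O -> connected_section F G.
Proof.
move=> FG; rewrite /connected_section !(rank_rk _ gr).
have [le2|gt2] := leqP (rk G) (rk F).+2; [left; lia|right].
pose reach A B := exists s, [/\ path (@incident _ coset_face) A s, all (in_section F G) s &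
  last A s = B].
have rtrans A B C : reach A B -> reach B C -> reach A C.
  move=> [s [ps Ss <-]] [t [pt St <-]]; exists (s ++ t).
  by rewrite cat_path ps pt all_cat Ss St last_cat.
have rup A B : in_section F G B -> (A <= B)%O -> reach A B.
  by move=> SB AB; exists [:: B]; rewrite /= /incident /Order.comparable AB SB.
have rdn A B : in_section F G B -> (B <= A)%O -> reach A B.
  by move=> SB AB; exists [:: B]; rewrite /= /incident /Order.comparable AB SB orbT.
have ltr (A B : coset_face) : (A <= B)%O -> (rk A < rk B)%N -> (A < B)%O.
  by move=> AB rAB; rewrite lt_neqAle AB andbT; apply: contraTneq rAB => ->; rewrite ltnn.
have [JG [g [gN eG]]] : exists J v, v \in parab setT /\ G = cface J v.
  by have [G0|//] := cface_cases G; move: gt2; rewrite G0 (rk0 gr).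
have inN u : u \in g *: parab JG -> u \in parab setT.
  move=> ug; rewrite -[u](mulKVg g) groupM //.
  by rewrite (fintype.subsetP (parab_sub (subsetT JG))) // -mem_lcoset.
have [F0|[JF [f [fN eF]]]] := cface_cases F.
  have J2 : (2 <= #|JG|)%N by move: gt2; rewrite eG F0 (rk0 gr) rk_cface.
  have sec K u : u \in g *: parab JG -> K \proper JG -> in_section F G (cface K u).
    move=> ug KJ; have uN := inN _ ug.
    by rewrite /in_section F0 eG bot_cface // lt_cface // KJ ug.
  have J0 : set0 \proper JG by rewrite properEcard sub0set cards0; lia.
  have J1 j : j \in JG -> [set j] \proper JG by move=> jJ; rewrite properEcard sub1set jJ cards1.
  have vv u : u \in g *: parab JG -> forall w, w \in g *: parab JG ->
      reach (cface set0 u) (cface set0 w).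
    move=> ug w wg; have {wg} : u^-1 * w \in parab JG by rewrite -mem_lcoset -(parab1 ug).
    rewrite -{2}[w](mulKVg u); move: (u^-1 * w) => h hJ.
    suff [] : h \in parab JG /\ reach (cface set0 u) (cface set0 (u * h)) by [].
    move: h hJ; apply: gen_ind => [|h s [hJ rh] /imsetP[j jJ ->]].
      by rewrite mulg1; split=> //; apply: rup => //; apply: sec.
    have uhg : u * h \in g *: parab JG by rewrite (parab1 ug) mem_lcoset mulKg.
    have uhxg : u * (h * x j) \in g *: parab JG.
      by rewrite (parab1 ug) mem_lcoset mulKg groupM // mem_parab.
    split; first by rewrite groupM // mem_parab.
    apply: (rtrans _ _ _ rh); apply: (rtrans _ (cface [set j] (u * h))).
      apply: rup; first by apply: sec => //; apply: J1.
      by rewrite le_cface ?inN // sub0set lcoset_refl.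
    apply: rdn; first exact: sec.
    rewrite le_cface ?inN // sub0set mem_lcoset [u * (h * _)]mulgA mulKg.
    by rewrite mem_parab // set11.
  move=> A B /andP[]; rewrite F0 => A0 AG /andP[B0 BG].
  have down C : (\bot%O < C)%O -> (C < G)%O -> exists K u,
      [/\ u \in g *: parab JG, K \proper JG & C = cface K u].
    move=> C0 CG; have [C0'|[K [u [uN eC]]]] := cface_cases C.
      by rewrite C0' ltxx in C0.
    by exists K, u; move: CG; rewrite eC eG lt_cface // => /andP[].
  have [K [u [ug KJ ->]]] := down _ A0 AG; have [L [w [wg LJ ->]]] := down _ B0 BG.
  rewrite -F0; apply: (rtrans _ (cface set0 u)).
    by apply: rdn; [apply: sec | rewrite le_cface ?inN // sub0set lcoset_refl].
  apply: (rtrans _ _ _ (vv _ ug _ wg)).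
  by apply: rup; [apply: sec | rewrite le_cface ?inN // sub0set lcoset_refl].
have JG3 : (#|JG| <= 3)%N by have := max_card [in JG]; rewrite card_ord.
have [JF0 JGT] : JF = set0 /\ JG = setT.
  move: gt2; rewrite eG eF !rk_cface // => gt2; split; apply/eqP.
    by rewrite -cards_eq0; lia.
  by rewrite eqEcard subsetT cardsT card_ord; lia.
have {}eG : G = cface setT f by rewrite eG JGT !cface_top.
have sec K : K != set0 -> (#|K| < 3)%N -> in_section F G (cface K f).
  move=> K0 K3; rewrite /in_section eF eG JF0 !lt_cface // !lcoset_refl !andbT.
  by rewrite proper0 K0 properEcard subsetT cardsT card_ord.
have secE A : in_section F G A -> exists K j, [/\ j \in K, (#|K| < 3)%N & A = cface K f].
  move=> /andP[FA AG]; have [A0|[K [u [uN eA]]]] := cface_cases A.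
    by move: FA; rewrite A0 ltx0.
  move: FA AG; rewrite eA eF eG JF0 !lt_cface // proper0 => /andP[/set0Pn[j jK] fu] /andP[KT _].
  exists K, j; split=> //; last by rewrite (cface_eq _ fu).
  by have := proper_card KT; rewrite cardsT card_ord.
move=> A B SA SB; have [K [i [iK K3 eA]]] := secE _ SA; have [L [j [jL L3 eB]]] := secE _ SB.
have i0 k : [set k] != set0 by apply/set0Pn; exists k; rewrite set11.
have ij0 : [set i; j] != set0 by apply/set0Pn; exists i; rewrite !inE eqxx.
have ij3 : (#|[set i; j]| < 3)%N by rewrite cards2; case: (_ != _).
rewrite eA in SA *; rewrite eB in SB *.
apply: (rtrans _ (cface [set i] f)).
  by apply: rdn; [apply: sec; rewrite ?cards1 | rewrite le_cface // sub1set iK lcoset_refl].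
apply: (rtrans _ (cface [set i; j] f)).
  by apply: rup; [apply: sec | rewrite le_cface // sub1set !inE eqxx lcoset_refl].
apply: (rtrans _ (cface [set j] f)).
  by apply: rdn; [apply: sec; rewrite ?cards1 | rewrite le_cface // sub1set !inE eqxx orbT
    lcoset_refl].
by apply: rup => //; rewrite le_cface // sub1set jL lcoset_refl.
Qed.

Lemma x_neq1 j : x j != 1.
Proof.
apply/eqP => e; have : x j \in parab set0 by rewrite e group1.
by move=> /indep; rewrite inE.
Qed.

(** A set of two colours is the complement of a singleton, and the two colours other than
i are i + 1 and i + 2 modulo 3. *)
Lemma ord3_succ_cases i k : k = i \/ k = (i + 1)%R \/ k = (i + 1 + 1)%R.
Proof.
move: k; elim/ord3_cases: i; elim/ord3_cases;
  try (by left; apply: val_inj); try (by right; left; apply: val_inj);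
  by right; right; apply: val_inj.
Qed.

Lemma ord3_succ_neq i : [/\ (i + 1)%R != i, (i + 1 + 1)%R != i & (i + 1 + 1)%R != (i + 1)%R].
Proof. by elim/ord3_cases: i. Qed.

(** An edge {v, v x_j} has two ends and lies in the two cosets vW_J with J a pair
containing j. In such a coset a vertex has one edge of each of the two colours. *)
Lemma coset_polyhedron : is_polyhedron coset_face.
Proof.
have xN j : x j \in parab setT by apply: mem_parab; rewrite inE.
have rkq (A : coset_face) (m : nat) : rank A = (m%:Z)%R <-> rk A = m.+1 := rank_eq A m gr.
have neq_vert v j : v \in parab setT -> cface set0 v <> cface set0 (v * x j).
  move=> vN /(cface_eqE vN (groupM vN (xN j)))[_].
  rewrite mem_lcoset parab_set0 inE invMg mulgKV.
  by rewrite invg_eq1 (negbTE (x_neq1 j)).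
split.
- exact: graded_five coset_graded.
- exact: coset_strong.
- move=> e /(rkq _ 1%N) /cface_of_rk[J [v [vN -> /eqP/cards1P[j ->]]]].
  apply: (card_pair (neq_vert v j vN)) => z; split.
    move=> [/(rkq _ 0%N) rz]; rewrite incident_lt ?rz ?rk_cface ?cards1 //.
    have [K [u [uN -> /eqP]]] := cface_of_rk rz; rewrite cards_eq0 => /eqP->.
    rewrite lt_cface // mem_lcoset => /andP[_]; rewrite parab_set1 !inE => /orP[]/eqP h.
      by left; rewrite -[u](mulKVg v) h mulg1.
    by right; rewrite -[u](mulKVg v) h.
  have vxN := groupM vN (xN j).
  have j0 : set0 \proper [set j] by rewrite properEcard sub0set cards0 cards1.
  move=> [->|->]; (split; first by apply/(rkq _ 0%N); rewrite rk_cface // cards0);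
    rewrite incident_lt ?rk_cface ?cards0 ?cards1 // lt_cface // j0 mem_lcoset.
    by rewrite mulVg group1.
  by rewrite mulKg mem_parab // set11.
- move=> e /(rkq _ 1%N) /cface_of_rk[J [v [vN -> /eqP/cards1P[j ->]]]].
  have [n1 n2 n12] := ord3_succ_neq j.
  have sub k : k != j -> [set j] \proper ~: [set k].
    by move=> kj; rewrite properEcard sub1set !inE eq_sym kj cardsC1 cards1 card_ord.
  apply: (@card_pair _ (cface (~: [set j + 1])%R v) (cface (~: [set j + 1 + 1])%R v)).
    move=> /(cface_eqE vN vN)[/setP/(_ (j + 1)%R)].
    by rewrite !inE eqxx eq_sym n12.
  move=> z; split.
    move=> [/(rkq _ 2%N) rz]; rewrite incident_lt ?rz ?rk_cface ?cards1 //.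
    have [K [u [uN -> K2]]] := cface_of_rk rz.
    have /cards1P[k Kk] : #|~: K| == 1%N by have := cardsC K; rewrite card_ord K2; lia.
    have {Kk K2}-> : K = ~: [set k] by rewrite -Kk setCK.
    rewrite lt_cface // => /andP[/proper_sub + vu].
    rewrite sub1set !inE => jk; rewrite -(cface_eq uN vu).
    by have [e'|[->|->]] := ord3_succ_cases j k; [rewrite e' eqxx in jk | left | right].
  move=> zk; have [k kj ->] : exists2 k, k != j & z = cface (~: [set k]) v.
    by case: zk => ->; [exists (j + 1)%R|exists (j + 1 + 1)%R].
  split; first by apply/(rkq _ 2%N); rewrite rk_cface // cardsC1 card_ord.
  by rewrite incident_lt ?rk_cface ?cardsC1 ?card_ord ?cards1 // lt_cface // sub // lcoset_refl.
move=> A B /(rkq _ 0%N) rA /(rkq _ 2%N) rB; rewrite incident_lt ?rA ?rB //.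
have [K0 [v [vN -> /eqP]]] := cface_of_rk rA; rewrite cards_eq0 => /eqP-> {rA}.
have [K [u [uN -> K2]]] := cface_of_rk rB => {rB}.
have /cards1P[k Kk] : #|~: K| == 1%N by have := cardsC K; rewrite card_ord K2; lia.
have {Kk K2}-> : K = ~: [set k] by rewrite -Kk setCK.
rewrite lt_cface // => /andP[_ vu]; rewrite -(cface_eq uN vu) => {u uN vu}.
have [n1 n2 n12] := ord3_succ_neq k.
have sub j : j != k -> [set j] \proper ~: [set k].
  by move=> kj; rewrite properEcard sub1set !inE kj cardsC1 cards1 card_ord.
have s0 j : set0 \proper [set j] by rewrite properEcard sub0set cards0 cards1.
apply: (@card_pair _ (cface [set k + 1]%R v) (cface [set k + 1 + 1]%R v)).
  move=> /(cface_eqE vN vN)[/setP/(_ (k + 1)%R)].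
  by rewrite !inE eqxx eq_sym (negbTE n12).
move=> z; split.
  move=> [/(rkq _ 1%N) rz]; rewrite !incident_lt ?rz ?rk_cface ?cards0 ?cardsC1 ?card_ord //.
  have [J [u [uN -> /eqP/cards1P[j ->]]]] := cface_of_rk rz.
  rewrite !lt_cface // => /andP[_ vu] /andP[/proper_sub + _].
  rewrite sub1set !inE => jk; rewrite -(cface_eq uN vu).
  by have [e'|[->|->]] := ord3_succ_cases k j; [rewrite e' eqxx in jk | left | right].
move=> zj; have [j jk ->] : exists2 j, j != k & z = cface [set j] v.
  by case: zj => ->; [exists (k + 1)%R|exists (k + 1 + 1)%R].
split; first by apply/(rkq _ 1%N); rewrite rk_cface // cards1.
  by rewrite incident_lt ?rk_cface ?cards0 ?cards1 // lt_cface // s0 lcoset_refl.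
by rewrite incident_lt ?rk_cface ?cardsC1 ?card_ord ?cards1 // lt_cface // sub // lcoset_refl.
Qed.

End CosetPoset.

(** * The flags of this polyhedron as group elements *)

Section Reflections.
Local Open Scope group_scope.
Variables (gT : groupType) (r : 'I_3 -> gT).
Local Notation a := (r o0).
Local Notation b := (r o1).
Local Notation c := (r o2).
Hypothesis rr : forall j, r j * r j = 1.
Hypothesis ac : a * c = c * a.
Hypothesis bcb : b * c * b = c * b * c.

(** The three conjugates of a under the group S_3 generated by b and c. *)
Definition reflections (j : 'I_3) : gT :=
  match val j with 0 => a | 1 => b * a * b | _ => c * b * a * b * c end.

(** The element of S_3 attached to the ordering of the generators that starts with i and
ends with k: it satisfies tau a = x_i tau, and multiplying it by b (by c) exchanges the
first two (last two) of the ordering. The value 1 covers the base ordering (0, 2) and the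
excluded case i = k. *)
Definition tau (i k : 'I_3) : gT :=
  match val i, val k with
  | 0, 1 => c | 1, 2 => b | 1, 0 => b * c | 2, 1 => c * b | 2, 0 => b * c * b | _, _ => 1
  end.

(** The remaining colour, since 0 + 1 + 2 = 0 modulo 3. *)
Definition third (i k : 'I_3) : 'I_3 := (- (i + k))%R.

Local Notation x := reflections.

Let rK j g : g * r j * r j = g. Proof. by rewrite -mulgA rr mulg1. Qed.

Lemma tau_a i k : i != k -> tau i k * a = x i * tau i k.
Proof.
elim/ord3_cases: i; elim/ord3_cases: k => //= _; rewrite /tau /reflections /= ?mulgA ?rK ?mulg1
  ?mul1g //.
- by rewrite -mulgA -ac mulgA.
- by rewrite bcb -!mulgA -ac !mulgA -(mulgA _ b c) -(mulgA _ (b * c) b) bcb !mulgA !rK.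
Qed.

Lemma tau_b i k : i != k -> tau i k * b = tau (third i k) k.
Proof.
by elim/ord3_cases: i; elim/ord3_cases: k => //= _; rewrite /tau /= ?rK ?rr ?mul1g.
Qed.

Lemma tau_c i k : i != k -> tau i k * c = tau i (third i k).
Proof.
elim/ord3_cases: i; elim/ord3_cases: k => //= _; rewrite /tau /= ?rK ?rr ?mul1g //.
by rewrite bcb rK.
Qed.

Lemma thirdP i k : i != k -> third i k != i /\ third i k != k.
Proof. by elim/ord3_cases: i; elim/ord3_cases: k. Qed.

Lemma reflections_sq j : x j * x j = 1.
Proof. by elim/ord3_cases: j; rewrite /reflections /= ?mulgA ?rK ?rr ?mul1g. Qed.

End Reflections.

Section CosetWalks.
Import mathcomp.boot.finset.
Local Close Scope classical_set_scope.
Local Open Scope set_scope.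
Local Open Scope group_scope.
Variables (gT : finGroupType) (r : 'I_3 -> gT).
Local Notation a := (r o0).
Local Notation b := (r o1).
Local Notation c := (r o2).
Hypothesis rr : forall j, r j * r j = 1.
Hypothesis ac : a * c = c * a.
Hypothesis bcb : b * c * b = c * b * c.
Local Notation x := (reflections r).
Local Notation tau := (tau r).
Let tau_a := tau_a rr ac bcb.
Let tau_b := tau_b rr.
Let tau_c := tau_c rr bcb.
Let reflections_sq := reflections_sq rr.

Hypothesis indep : forall J j, x j \in parab x J -> j \in J.
Hypothesis tau_inj : forall i k i' k', i != k -> i' != k' ->
  tau i k * (tau i' k')^-1 \in parab x setT -> i = i' /\ k = k'.

Local Notation T := (coset_face x).
Let pT : is_polyhedron T := coset_polyhedron reflections_sq indep.
Let gr := polyhedron_graded pT.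
Let dia := polyhedron_diamond pT.

Let xN j : x j \in parab x setT. Proof. by apply: mem_parab; rewrite inE. Qed.

(** The edge of the flag has the colour set {i} and its 2-face the complement of {k}, so i
and k give the ordering of the generators that goes with the flag. *)
Definition flag_coord (F : flag T) v i k :=
  [/\ v \in parab x setT, i != k, el F 1 = cface x set0 v,
      el F 2 = cface x [set i] v & el F 3 = cface x (~: [set k]) v].

Lemma flag_coord_ex v i k : v \in parab x setT -> i != k -> exists F, flag_coord F v i k.
Proof.
move=> vN ik; have [|F FP] := @sorted_flag _ T [:: cface x set0 v; cface x [set i] v; cface x
  (~: [set k]) v].
  by rewrite /= !(le_cface indep) // !lcoset_refl sub0set sub1set !inE ik.
have elE i' z : F z -> rk z = i' -> el F i' = z by move=> Fz <-; apply: el_mem.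
exists F; split=> //.
- by apply: elE; [apply: FP; rewrite !inE eqxx | rewrite rk_cface ?cards0].
- by apply: elE; [apply: FP; rewrite !inE eqxx !orbT | rewrite rk_cface ?cards1].
- by apply: elE; [apply: FP; rewrite !inE eqxx !orbT | rewrite rk_cface ?cardsC1 ?card_ord].
Qed.

Lemma flag_coord_total F : exists v i k, flag_coord F v i k.
Proof.
have [J1 [v [vN e1 /eqP]]] := cface_of_rk indep (rk_el gr F (isT : (1 <= 4)%N)).
rewrite cards_eq0 => /eqP J0; subst J1.
have [J2 [u [uN e2 /eqP/cards1P[i Ji]]]] := cface_of_rk indep (rk_el gr F (isT : (2 <= 4)%N)).
have [J3 [w [wN e3 J3E]]] := cface_of_rk indep (rk_el gr F (isT : (3 <= 4)%N)).
subst J2.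
have /cards1P[k Kk] : #|~: J3| == 1%N by have := cardsC J3; rewrite card_ord J3E; lia.
have {Kk J3E}eJ : J3 = ~: [set k] by rewrite -Kk setCK.
subst J3; have l12 : (el F 1 <= el F 2)%O by apply: el_le.
have l23 : (el F 2 <= el F 3)%O by apply: el_le.
have l13 : (el F 1 <= el F 3)%O by apply: el_le.
move: l12 l23 l13; rewrite e1 e2 e3 !(le_cface indep) // => /andP[_ vu] /andP[+ _] /andP[_ vw].
rewrite sub1set !inE => ik; exists v, i, k; split=> //.
  by rewrite e2 -(cface_eq uN vu).
by rewrite e3 -(cface_eq wN vw).
Qed.

Lemma flag_coord_inj F F' v i k : flag_coord F v i k -> flag_coord F' v i k -> F = F'.
Proof.
move=> [_ _ e1 e2 e3] [_ _ e1' e2' e3']; apply: (el_inj gr); elim/ord3_cases => /=.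
- by rewrite e1 e1'.
- by rewrite e2 e2'.
- by rewrite e3 e3'.
Qed.

Lemma flag_coord_uniq F v i k v' i' k' : flag_coord F v i k -> flag_coord F v' i' k' ->
  [/\ v = v', i = i' & k = k'].
Proof.
move=> [vN _ e1 e2 e3] [vN' _]; rewrite e1 e2 e3.
move=> /(cface_eqE indep vN vN')[_]; rewrite mem_lcoset parab_set0 inE => /eqP e.
move=> /(cface_eqE indep vN vN')[/set1_inj-> _] /(cface_eqE indep vN vN')[/setC_inj/set1_inj-> _].
by split=> //; rewrite -[v](mulKVg v') e mulg1.
Qed.

(** Changing the vertex moves along the edge; changing the edge or the face permutes the
colours. *)
Lemma flag_coord_adj F v i k : flag_coord F v i k ->
  [/\ flag_coord (adj o0 F) (v * x i) i k,
      flag_coord (adj o1 F) v (third i k) k &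
      flag_coord (adj o2 F) v i (third i k)].
Proof.
move=> C; have [vN ik e1 e2 e3] := C; have [t1 t2] := thirdP ik.
have vxN := groupM vN (xN i).
have neq F' v' i' k' : flag_coord F' v' i' k' -> (v', i', k') != (v, i, k) -> F' <> F.
  by move=> C' /eqP + E; rewrite E in C'; have [-> -> ->] := flag_coord_uniq C C'.
have memi (J : {set 'I_3}) : i \in J -> cface x J (v * x i) = cface x J v.
  by move=> iJ; apply: cface_eq => //; rewrite mem_lcoset mulKg mem_parab.
split.
- have [F' C'] := flag_coord_ex vxN ik; rewrite (adj_uniq gr dia (Psi' := F')) //.
  apply/(adjacentE gr); split.
    apply: (neq _ _ _ _ C'); apply/eqP => -[/eqP]; rewrite -{2}[v]mulg1 (inj_eq (mulgI v)).
    by rewrite (negbTE (x_neq1 indep i)).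
  case: C' => _ _ _ e2' e3'; elim/ord3_cases => //= _.
    by rewrite e2 e2' memi // set11.
  by rewrite e3 e3' memi // !inE.
- have [F' C'] := flag_coord_ex vN t2; rewrite (adj_uniq gr dia (Psi' := F')) //.
  apply/(adjacentE gr); split.
    by apply: (neq _ _ _ _ C'); apply/eqP => -[/eqP]; rewrite (negbTE t1).
  by case: C' => _ _ e1' e2' e3'; elim/ord3_cases => //= _; rewrite ?e1 ?e3 ?e1' ?e3'.
- have it : i != third i k by rewrite eq_sym.
  have [F' C'] := flag_coord_ex vN it; rewrite (adj_uniq gr dia (Psi' := F')) //.
  apply/(adjacentE gr); split.
    by apply: (neq _ _ _ _ C'); apply/eqP => -[/eqP]; rewrite (negbTE t2).
  by case: C' => _ _ e1' e2' e3'; elim/ord3_cases => //= _; rewrite ?e1 ?e2 ?e1' ?e2'.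
Qed.

(** Flags are labelled by the elements v tau of the group, and adjacency becomes right
multiplication by a generator. *)
Definition flag_label F g := exists v i k, flag_coord F v i k /\ g = v * tau i k.

Lemma flag_label_adj F g k : flag_label F g -> flag_label (adj k F) (g * r k).
Proof.
move=> [v [i [m [C ->]]]]; have [vN im _ _ _] := C; have [C0 C1 C2] := flag_coord_adj C.
elim/ord3_cases: k.
- by exists (v * x i), i, m; split=> //; rewrite -!mulgA tau_a.
- by exists v, (third i m), m; split=> //; rewrite -!mulgA tau_b.
- by exists v, i, (third i m); split=> //; rewrite -!mulgA tau_c.
Qed.

Lemma flag_label_walk F g w : flag_label F g -> flag_label (walk F w) (g * eval r w).
Proof.
elim: w F g => [|[k e] w IH] F g L; first by rewrite /eval big_nil mulg1.
rewrite /eval big_cons /= mulgA; apply: IH.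
have -> : (if e then (r k)^-1 else r k) = r k.
  by case: e => //; apply: (mulgI (r k)); rewrite mulgV rr.
exact: flag_label_adj.
Qed.

Lemma flag_label_inj F F' g : flag_label F g -> flag_label F' g -> F = F'.
Proof.
move=> [v [i [k [C ->]]]] [v' [i' [k' [C' E]]]].
have [vN ik _ _ _] := C; have [vN' ik' _ _ _] := C'.
have [] := tau_inj ik ik'.
  rewrite (_ : tau i k * _ = v^-1 * v') ?groupM ?groupV //.
  by apply: (mulgI v); rewrite mulKVg mulgA E mulgK.
move=> ei ek; subst i' k'; move: E => /mulIg ev; subst v'.
exact: flag_coord_inj C C'.
Qed.

(** The labels are unique, so a walk returns when the product of its letters is 1,
whatever its starting flag. *)
Lemma coset_walk (F : flag T) w : walk F w = F <-> eval r w = 1.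
Proof.
have [v [i [k C]]] := flag_coord_total F.
have L : flag_label F (v * tau i k) by exists v, i, k.
have Lw := flag_label_walk w L; split=> [Fw|e]; last first.
  by rewrite e mulg1 in Lw; apply: flag_label_inj Lw L.
rewrite Fw in Lw; have [v' [i' [k' [C' E]]]] := Lw.
have [ev ei ek] := flag_coord_uniq C C'; subst v' i' k'.
by apply: (mulgI (v * tau i k)); rewrite E mulg1.
Qed.

Lemma coset_regular : is_regular T.
Proof. by apply: regular_of_walks => // Phi Psi w /coset_walk e; apply/coset_walk. Qed.
End CosetWalks.

(** * The flags of the prism *)

Section PrismFlags.
Import mathcomp.boot.finset.
Local Close Scope classical_set_scope.
Local Open Scope set_scope.
Local Open Scope ring_scope.
Variable n : nat.
Hypothesis hn : (3 <= n)%N.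
Implicit Types (i j : 'Z_n).

Lemma Zn1 : (1 : 'Z_n) != 0.
Proof. by case: n hn => [|[|[|m]]]. Qed.
Lemma Zn2 : (1 + 1 : 'Z_n) != 0.
Proof. by case: n hn => [|[|[|m]]]. Qed.

Lemma neq_succ j : (j == j + 1) = false.
Proof. by rewrite -{1}[j]addr0 (inj_eq (addrI j)) eq_sym (negbTE Zn1). Qed.
Lemma neq_succ2 j : (j == j + 1 + 1) = false.
Proof. by rewrite -addrA -{1}[j]addr0 (inj_eq (addrI j)) eq_sym (negbTE Zn2). Qed.

(** The nonempty faces of the prism are the products of a nonempty face of a segment (None
for the segment itself, Some b for one of its ends) with a nonempty face of the n-gon. The
face Side i joins i and i + 1. *)
Inductive polygon_face := Point of 'Z_n | Side of 'Z_n | Whole.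
Implicit Types (s : option bool) (p : polygon_face).

Definition in_segment s (b : bool) : bool := if s is Some b' then b == b' else true.
Definition in_polygon p i : bool :=
  match p with Point j => i == j | Side j => (i == j) || (i == j + 1) | Whole => true end.

Definition product_face s p : {set prism_vertex n} :=
  [set v | in_segment s v.1 && in_polygon p v.2].

Definition segment_le s s' : bool := if s' is Some _ then s == s' else true.
Definition polygon_le p p' : bool :=
  match p, p' with
  | _, Whole => true
  | Point i, Point i' => i == i'
  | Point i, Side j => (i == j) || (i == j + 1)
  | Side j, Side j' => j == j'
  | _, _ => false
  end.

(** Here n >= 3 matters: in a digon two sides would have the same vertices. *)
Lemma polygon_leP p p' : reflect (forall i, in_polygon p i -> in_polygon p' i) (polygon_le p p').
Proof.
apply: (iffP idP).
  case: p p' => [i|j|] [i'|j'|] //=; [by move=> /eqP->|by move=> ii' k /eqP->|by move=> /eqP->].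
case: p p' => [i|j|] [i'|j'|] //= H.
- by have := H i; rewrite /= eqxx; apply.
- by have := H i; rewrite /= eqxx; apply.
- have := H (j + 1); rewrite /= eqxx orbT => /(_ isT) /eqP e1.
  have := H j; rewrite /= eqxx => /(_ isT) /eqP e2.
  by have := neq_succ j; rewrite e1 e2 eqxx.
- have := H j; rewrite /= eqxx => /(_ isT) /orP[//|/eqP e1].
  have := H (j + 1); rewrite /= eqxx orbT e1 => /(_ isT) /orP[|].
    by rewrite eq_sym neq_succ2.
  by rewrite eq_sym neq_succ.
- have /= /eqP e1 := H 1 isT; have /= /eqP e2 := H 0 isT.
  by have := Zn1; rewrite e1 e2 eqxx.
- have /= := H (j' + 1 + 1) isT; rewrite eq_sym neq_succ2 /= eq_sym.
  by rewrite neq_succ.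
Qed.

Lemma segment_leP s s' : reflect (forall b, in_segment s b -> in_segment s' b) (segment_le s s').
Proof.
apply: (iffP idP); case: s s' => [b|] [b'|] //=.
- by move=> /eqP[->].
- by move=> H; have := H b; rewrite eqxx => /(_ isT) /eqP->.
- by move=> H; have := H (~~ b') isT; case: b' {H}.
Qed.

Lemma product_face_sub s p s' p' :
  (product_face s p \subset product_face s' p') = segment_le s s' && polygon_le p p'.
Proof.
have [b sb] : exists b, in_segment s b by case: s => [b|]; [exists b => /= | exists true].
have [i pi] : exists i, in_polygon p i.
  by case: p => [i|i|]; [exists i|exists i|exists 0]; rewrite /= ?eqxx.
apply/fintype.subsetP/andP => [H|[/segment_leP ss /polygon_leP pp] v]; last first.
  by rewrite !inE => /andP[/ss-> /pp->].
split; [apply/segment_leP => b' sb' | apply/polygon_leP => i' pi'].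
  by have := H (b', i); rewrite !inE /= sb' pi => /(_ isT) /andP[].
by have := H (b, i'); rewrite !inE /= sb pi' => /(_ isT) /andP[].
Qed.

Lemma is_prism_face_product s p : is_prism_face (product_face s p).
Proof.
rewrite /is_prism_face; case: s p => [b|] [j|j|].
- apply/orP; right; apply/orP; left; apply/existsP; exists j.
  case: b; apply/orP; [right|left]; apply/eqP/setP => -[b' k];
   by rewrite !inE xpair_eqE; case: b'.
- do 2!(apply/orP; right); apply/orP; left; apply/existsP; exists j.
  case: b; apply/or3P; [apply: Or32|apply: Or31]; apply/eqP/setP => -[b' k];
   by rewrite !inE !xpair_eqE; case: b'.
- do 3!(apply/orP; right); case: b; [apply/orP; right|]; apply/orP; left; apply/eqP/setP =>
  -[b' k];
    rewrite !inE /= andbT; apply/eqP/imsetP => [->|[k' _ [-> _]] //]; by exists k.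
- do 2!(apply/orP; right); apply/orP; left; apply/existsP; exists j.
  by apply/or3P; apply: Or33; apply/eqP/setP => -[b' k]; rewrite !inE !xpair_eqE; case: b';
    rewrite /= ?orbF.
- do 5!(apply/orP; right); apply/orP; left; apply/existsP; exists j.
  apply/eqP/setP => -[b' k]; rewrite !inE !xpair_eqE; case: b'; rewrite /= ?orbF //.
  by rewrite orbC.
- by do 6!(apply/orP; right); apply/eqP/setP => -[b' k]; rewrite !inE.
Qed.

Definition pface s p : prism n := Prism (is_prism_face_product s p).

Lemma pface_le s p s' p' : (pface s p <= pface s' p')%O = segment_le s s' && polygon_le p p'.
Proof. exact: product_face_sub. Qed.

Lemma pface_cases (A : prism n) : A = \bot%O \/ exists s p, A = pface s p.
Proof.
suff: prism_set A = set0 \/ exists s p, prism_set A = product_face s p.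
  by move=> [A0|[s [p Ap]]]; [left | right; exists s, p]; apply: val_inj.
case: A => A /=; rewrite /is_prism_face.
move=> /orP[/eqP|]; [by left|move=> H; right; move: H].
move=> /orP[/existsP[i /orP[]/eqP->]|].
- exists (Some false), (Point i); apply/setP => -[b k]; rewrite !inE xpair_eqE; by case: b.
- exists (Some true), (Point i); apply/setP => -[b k]; rewrite !inE xpair_eqE; by case: b.
move=> /orP[/existsP[i /or3P[]/eqP->]|].
- exists (Some false), (Side i); apply/setP => -[b k]; rewrite !inE !xpair_eqE; by case: b.
- exists (Some true), (Side i); apply/setP => -[b k]; rewrite !inE !xpair_eqE; by case: b.
- exists None, (Point i); apply/setP => -[b k]; rewrite !inE !xpair_eqE; by case: b; rewrite /=
  ?orbF.
move=> /orP[/eqP->|].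
  exists (Some false), Whole; apply/setP => -[b k]; rewrite !inE /= andbT.
  by apply/imsetP/eqP => [[k' _ [-> _]] //|->]; exists k.
move=> /orP[/eqP->|].
  exists (Some true), Whole; apply/setP => -[b k]; rewrite !inE /= andbT.
  by apply/imsetP/eqP => [[k' _ [-> _]] //|->]; exists k.
move=> /orP[/existsP[i /eqP->]|/eqP->].
  exists None, (Side i); apply/setP => -[b k]; rewrite !inE !xpair_eqE.
  by case: b; rewrite /= ?orbF // orbC.
by exists None, Whole; apply/setP => -[b k]; rewrite !inE.
Qed.

Lemma polygon_le_anti p p' : polygon_le p p' -> polygon_le p' p -> p = p'.
Proof. by case: p p' => [i|i|] [i'|i'|] //= /eqP->. Qed.

Lemma segment_le_anti s s' : segment_le s s' -> segment_le s' s -> s = s'.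
Proof. by case: s s' => [b|] [b'|] //= /eqP. Qed.

Lemma pface_inj s p s' p' : pface s p = pface s' p' -> s = s' /\ p = p'.
Proof.
move=> E; have /andP[] : segment_le s s' && polygon_le p p' by rewrite -pface_le E.
have /andP[s's p'p] : segment_le s' s && polygon_le p' p by rewrite -pface_le E.
by move=> /segment_le_anti-> // /polygon_le_anti->.
Qed.

Definition segment_dim s : nat := if s is None then 1 else 0.
Definition polygon_dim p : nat := match p with Point _ => 0 | Side _ => 1 | Whole => 2 end.

Lemma segment_le_dim s s' : segment_le s s' -> (segment_dim s <= segment_dim s')%N.
Proof. by case: s s' => [b|] [b'|]. Qed.
Lemma polygon_le_dim p p' : polygon_le p p' -> (polygon_dim p <= polygon_dim p')%N.
Proof. by case: p p' => [i|i|] [i'|i'|]. Qed.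
Lemma segment_dim_eq s s' : segment_le s s' -> segment_dim s = segment_dim s' -> s = s'.
Proof. by case: s s' => [b|] [b'|] //= /eqP. Qed.
Lemma polygon_dim_eq p p' : polygon_le p p' -> polygon_dim p = polygon_dim p' -> p = p'.
Proof. by case: p p' => [i|i|] [i'|i'|] //= /eqP->. Qed.
Lemma segment_le_refl s : segment_le s s. Proof. by case: s => [b|] /=. Qed.
Lemma polygon_le_refl p : polygon_le p p. Proof. by case: p => [i|i|] /=. Qed.

Lemma pface_neq_bot s p : pface s p <> \bot%O.
Proof.
have [b sb] : exists b, in_segment s b by case: s => [b|]; [exists b => /= | exists true].
have [i pi] : exists i, in_polygon p i.
  by case: p => [i|i|]; [exists i|exists i|exists 0]; rewrite /= ?eqxx.
by move=> /(congr1 (@prism_set n))/setP/(_ (b, i)); rewrite !inE /= sb pi.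
Qed.

Lemma pface_lt s p s' p' : (pface s p < pface s' p')%O ->
  (segment_dim s + polygon_dim p < segment_dim s' + polygon_dim p')%N.
Proof.
rewrite lt_neqAle pface_le => /and3P[/eqP neq ss pp].
have ds := segment_le_dim ss; have dp := polygon_le_dim pp.
rewrite ltn_neqAle leq_add // andbT; apply/eqP => e; apply: neq.
by rewrite (segment_dim_eq ss) 1?(polygon_dim_eq pp) //; lia.
Qed.

Lemma lt_pface s p s' p' : segment_le s s' -> polygon_le p p' ->
  (segment_dim s + polygon_dim p < segment_dim s' + polygon_dim p')%N ->
  (pface s p < pface s' p')%O.
Proof.
move=> ss pp d; rewrite lt_neqAle pface_le ss pp !andbT.
by apply/eqP => /pface_inj[es ep]; rewrite es ep ltnn in d.
Qed.

Lemma bot_pface s p : (\bot%O < pface s p)%O.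
Proof. by rewrite lt_neqAle le0x andbT eq_sym; apply/eqP/pface_neq_bot. Qed.

(** The rank is the sum of the dimensions of the two factors. *)
Lemma prism_graded_ex : exists2 r : prism n -> nat, graded r &
  forall s p, r (pface s p) = (segment_dim s + polygon_dim p).+1.
Proof.
have /choice[r rP] : forall A : prism n, exists m, (A = \bot%O -> m = 0%N) /\
    forall s p, A = pface s p -> m = (segment_dim s + polygon_dim p).+1.
  move=> A; have [->|[s [p ->]]] := pface_cases A.
    by exists 0%N; split=> // s p /esym/pface_neq_bot.
  exists (segment_dim s + polygon_dim p).+1; split=> [/pface_neq_bot//|s' p'].
  by move=> /pface_inj[-> ->].
have r0 : r \bot%O = 0%N by have [->] := rP \bot%O.
have rE s p : r (pface s p) = (segment_dim s + polygon_dim p).+1 by apply: (rP _).2.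
exists r => //; split=> //.
- rewrite (_ : \top%O = pface None Whole) ?rE //; apply: val_inj; apply/setP => v.
  by rewrite !inE.
- move=> A B; have [->|[s [p ->]]] := pface_cases A;
   have [->|[s' [p' ->]]] := pface_cases B; rewrite ?ltxx ?ltx0 // !(r0, rE) //.
  by rewrite ltnS; apply: pface_lt.
move=> A B; have [->|[s [p ->]]] := pface_cases A;
  have [->|[s' [p' ->]]] := pface_cases B; rewrite ?ltxx ?ltx0 // !(r0, rE).
  move=> _ d; have [b sb] : exists b, in_segment s' b.
    by case: (s') => [b|]; [exists b => /= | exists true].
  have [i pi] : exists i, in_polygon p' i.
    by case: (p') => [i|i|]; [exists i|exists i|exists 0]; rewrite /= ?eqxx.
  exists (pface (Some b) (Point i)); first exact: bot_pface.
  apply: lt_pface => /=; last by rewrite -ltnS.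
    by case: (s') sb => //= b' /eqP->.
  by case: (p') pi.
rewrite lt_neqAle pface_le => /and3P[_ ss pp] d.
have := segment_le_dim ss; rewrite leq_eqVlt => /predU1P[/(segment_dim_eq ss) es|ds].
  have [i [ep ep']] : exists i, p = Point i /\ p' = Whole.
    by move: d; rewrite es; case: (p) (p') pp => [i|i|] [i'|i'|] //= _; try lia; exists i.
  subst s' p p'; exists (pface s (Side i)); apply: lt_pface;
    rewrite ?segment_le_refl //= ?eqxx //; lia.
exists (pface s' p); apply: lt_pface; rewrite ?segment_le_refl ?polygon_le_refl //; first lia.
by move: d ds; case: (s) (s') => [?|] [?|] /=; lia.
Qed.

Lemma prism_gr : graded (@rk _ (prism n)).
Proof. by have [r gr _] := prism_graded_ex; apply: graded_rk gr. Qed.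

Lemma rk_pface s p : rk (pface s p) = (segment_dim s + polygon_dim p).+1.
Proof. by have [r gr rE] := prism_graded_ex; rewrite (rkE _ gr) rE. Qed.

(** Coordinates (t, b, i, e) of the flags: the type t, the vertex i of the n-gon b, and
the direction e of the flag, towards i + 1 or (e = true) towards i - 1. On a flag of type
0 the edge is a rung and the direction is the one in which the face lies; on types 1 and 2
the direction is that of the edge. *)
Definition dart : finType := ('I_3 * bool * 'Z_n * bool)%type.
Implicit Types (x : dart).

Definition other_end i (e : bool) : 'Z_n := if e then i - 1 else i + 1.
Definition side_index i (e : bool) : 'Z_n := if e then i - 1 else i.

(** Changing the edge exchanges the types 0 and 1, as the two edges at a vertex of a
square are a rung and a side; changing the face exchanges the types 1 and 2, as a side
lies in a square and an n-gon. *)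
Definition dart_step (k : 'I_3) x : dart :=
  let: (t, b, i, e) := x in
  match val k, val t with
  | 0, 0 => (t, ~~ b, i, e)
  | 0, _ => (t, b, other_end i e, ~~ e)
  | 1, 0 => (inord 1, b, i, e)
  | 1, 1 => (inord 0, b, i, e)
  | 1, _ => (t, b, i, ~~ e)
  | _, 0 => (t, b, i, ~~ e)
  | _, 1 => (inord 2, b, i, e)
  | _, _ => (inord 1, b, i, e)
  end.

Lemma dart_stepK k : involutive (dart_step k).
Proof.
move=> [[[t b] i] e]; rewrite /dart_step; elim/ord3_cases: k; elim/ord3_cases: t => /=; rewrite
  ?inordK ?negbK //=.
- by case: e; rewrite /other_end /= ?subrK ?addrK.
- by case: e; rewrite /other_end /= ?subrK ?addrK.
all: by congr (_, _, _, _); apply: val_inj; rewrite /= inordK.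
Qed.

Definition dart_face x (k : 'I_3) : option bool * polygon_face :=
  let: (t, b, i, e) := x in
  match val k with
  | 0 => (Some b, Point i)
  | 1 => if val t == 0%N then (None, Point i) else (Some b, Side (side_index i e))
  | _ => if val t == 2%N then (Some b, Whole) else (None, Side (side_index i e))
  end.

Local Notation df x k := (pface (dart_face x k).1 (dart_face x k).2).

Definition flag_of_dart x (F : flag (prism n)) := forall k : 'I_3, el F k.+1 = df x k.

Lemma dart_side i e : polygon_le (Point i) (Side (side_index i e)).
Proof. by rewrite /= /side_index; case: e; rewrite ?eqxx // subrK eqxx orbT. Qed.

Lemma flag_of_dart_ex x : exists F, flag_of_dart x F.
Proof.
have [|F FP] := @sorted_flag _ (prism n) [:: df x o0; df x o1; df x o2].
  case: x => [[[t b] i] e] /=; rewrite andbT; elim/ord3_cases: t => /=;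
  by rewrite !pface_le ?dart_side ?segment_le_refl ?polygon_le_refl.
have rkf k : rk (df x k) = k.+1.
  case: x {FP} => [[[t b] i] e]; elim/ord3_cases: k; elim/ord3_cases: t => /=;
  by rewrite rk_pface.
exists F => k; rewrite -(rkf k); apply: (el_mem prism_gr); apply: FP.
by elim/ord3_cases: k; rewrite !inE eqxx ?orbT.
Qed.

Lemma dart_of_flag F : exists x, flag_of_dart x F.
Proof.
have face m : (m < 4)%N -> exists s p, el F m.+1 = pface s p /\ (segment_dim s + polygon_dim
  p)%N = m.
  move=> m4; have [e|[s [p e]]] := pface_cases (el F m.+1).
    by have := rk_el prism_gr F m4; rewrite e (rk0 prism_gr).
  exists s, p; split=> //; have := rk_el prism_gr F m4.
  by rewrite e rk_pface => -[].
have [s1 [p1 [e1 d1]]] := face 0%N isT; have [s2 [p2 [e2 d2]]] := face 1%N isT.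
have [s3 [p3 [e3 d3]]] := face 2%N isT.
have := el_le prism_gr F (isT : (2 <= 4)%N) (isT : (1 <= 2)%N).
have := el_le prism_gr F (isT : (3 <= 4)%N) (isT : (2 <= 3)%N).
rewrite e1 e2 e3 !pface_le => /andP[s23 p23] /andP[s12 p12].
have [b es1] : exists b, s1 = Some b by case: s1 d1 {e1 s12} => // b _; exists b.
have [i ep1] : exists i, p1 = Point i by case: p1 d1 {e1 p12} => [i|i|] //; rewrite ?addnS //
  => _; exists i.
subst s1 p1.
have side j : polygon_le (Point i) (Side j) -> exists e, j = side_index i e.
  by move=> /orP[]/eqP->; [exists false|exists true; rewrite /= addrK].
suff [t [e [E2 E3]]] : exists t e, (s2, p2) = dart_face (t, b, i, e) o1 /\
    (s3, p3) = dart_face (t, b, i, e) o2.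
  exists (t, b, i, e); elim/ord3_cases => //.
    by rewrite -E2.
  by rewrite -E3.
case: s2 p2 d2 s12 p12 s23 p23 {e2} => [b2|] [i2|j2|] //= _.
  move=> /eqP[<-] /side[e ->]; case: s3 p3 d3 {e3} => [b3|] [i3|j3|] //= _.
    by move=> /eqP[<-] _; exists o2, e.
  by move=> _ /eqP<-; exists o1, e.
move=> _ /eqP<-; case: s3 p3 d3 {e3} => [b3|] [i3|j3|] //= _ _ /side[e ->].
by exists o0, e.
Qed.

Lemma side_index_inj i : injective (side_index i).
Proof.
have h : i - 1 <> i by move=> /eqP; rewrite subr_eq neq_succ.
by rewrite /side_index => -[] [] // e; case: h; first [exact: e | exact: esym e].
Qed.

Lemma flag_of_dart_inj x y F : flag_of_dart x F -> flag_of_dart y F -> x = y.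
Proof.
move=> xF yF; have E k : dart_face x k = dart_face y k.
  have := xF k; rewrite yF => /pface_inj[].
  by case: (dart_face x k) (dart_face y k) => ? ? [? ?] /= -> ->.
case: x y {xF yF} E => [[[t b] i] e] [[[t' b'] i'] e'] E.
have [eb ei] := E o0; subst b' i'.
have := E o1; have := E o2; rewrite /dart_face /=.
elim/ord3_cases: t {E}; elim/ord3_cases: t' => /= e3 e2.
all: by first [case: e3 => /side_index_inj-> | case: e2 => /side_index_inj-> | case: e3 | case:
  e2].
Qed.

Lemma dart_face_step x (k j : 'I_3) : j != k -> dart_face (dart_step k x) j = dart_face x j.
Proof.
case: x => [[[t b] i] e]; rewrite /dart_step.
elim/ord3_cases: k; elim/ord3_cases: j => //= _; elim/ord3_cases: t;
  rewrite /= ?inordK //; by case: e; rewrite /side_index /other_end /= ?addrK.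
Qed.

Lemma dart_step_neq x (k : 'I_3) : dart_step k x <> x.
Proof.
case: x => [[[t b] i] e]; rewrite /dart_step.
have io m : (m < 3)%N -> val (inord m : 'I_3) = m by move=> ?; rewrite /= inordK.
elim/ord3_cases: k; elim/ord3_cases: t => /= [] h;
  try (by case: h; case: b); try (by case: h; case: e);
  by case: h => /(congr1 val); rewrite io.
Qed.

Lemma flag_of_dart_uniq x F F' : flag_of_dart x F -> flag_of_dart x F' -> F = F'.
Proof. by move=> xF xF'; apply: (el_inj prism_gr) => k; rewrite xF xF'. Qed.

Lemma flag_of_dart_adjacent x (k : 'I_3) F F' :
  flag_of_dart x F -> flag_of_dart (dart_step k x) F' -> adjacent k F F'.
Proof.
move=> xF xF'; apply/(adjacentE prism_gr); split.
  by move=> E; rewrite E in xF'; apply: (@dart_step_neq x k); apply: flag_of_dart_inj xF' xF.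
by move=> j jk; rewrite xF xF' dart_face_step.
Qed.

(** In each of the three cases the faces between the two neighbours are found among the
products of [pface_cases]: either that of the flag or that of the flag obtained by
[dart_step]. *)
Lemma prism_diamond : @diamond _ (prism n).
Proof.
move=> F k; have [x xF] := dart_of_flag F; have [F' xF'] := flag_of_dart_ex (dart_step k x).
have /(adjacentE prism_gr)[neq agree] := flag_of_dart_adjacent xF xF'.
exists (el F' k.+1).
  move=> e; apply: neq; apply: (el_inj prism_gr) => j.
  by have [->|jk] := eqVneq j k; [|apply: agree].
move=> z; split; last first.
  by move=> e; case: e => ->; apply: (el_between prism_gr) => j jk; rewrite ?agree.
move=> /andP[Fz zF]; have k4 : (k.+2 <= 4)%N := ltn_ord k.
have rz : rk z = k.+1.
  have rF m : (m <= 4)%N -> rk (el F m) = m := @rk_el _ _ prism_gr F m.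
  have k4' := ltnW k4; have k4'' := ltnW k4'.
  by rewrite (between_rk prism_gr _ Fz zF) !rF.
have [ez|[s [p ez]]] := pface_cases z; first by move: rz; rewrite ez (rk0 prism_gr).
subst z; rewrite xF xF'; move: rz; rewrite rk_pface => -[d].
have {Fz}low : (el F k <= pface s p)%O := ltW Fz.
have {zF}up : (pface s p <= el F k.+2)%O := ltW zF.
case: x xF {F' xF' neq agree} => [[[t b] i] e] xF.
have sideP j : polygon_le (Point i) (Side j) -> j = side_index i e \/ j = side_index i (~~ e).
  by rewrite /side_index => /orP[]/eqP ->; case: e {xF} => /=; rewrite ?addrK; auto.
have ptP j : polygon_le (Point j) (Side (side_index i e)) -> j = i \/ j = other_end i e.
  rewrite /side_index /other_end => /orP[]/eqP ->; case: e {xF sideP} => /=; rewrite ?subrK; auto.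
elim/ord3_cases: k d low up {k4} => d low up.
- case: s p d low up => [b'|] [j|j|] //= _ _; rewrite (xF o1) /= pface_le.
  elim/ord3_cases: t {xF} => /=.
  + by move=> /eqP->; case: b b' => -[]; auto.
  + by move=> /andP[/eqP[->] /ptP[]->]; auto.
  + by move=> /andP[/eqP[->] /ptP[]->]; auto.
- move: low up; rewrite (xF o0) (xF o2) !pface_le.
  case: s p d => [b'|] [j|j|] //= _; elim/ord3_cases: t {xF} => /=; rewrite ?inordK //=.
  + by move=> /andP[/eqP[<-] _] /eqP->; auto.
  + by move=> /andP[/eqP[<-] _] /eqP->; auto.
  + by move=> /andP[/eqP[<-] /sideP[]->]; auto.
  + by move=> /eqP-> _; auto.
  + by move=> /eqP-> _; auto.
- move: low; rewrite (xF o1) pface_le.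
  case: s p d {up} => [b'|] [j|j|] //= _; elim/ord3_cases: t {xF} => /=; rewrite ?inordK //=.
  + by move=> /andP[/eqP[<-] _]; auto.
  + by move=> /andP[/eqP[<-] _]; auto.
  + by move=> /sideP[]->; auto.
  + by move=> /eqP<-; auto.
  + by move=> /eqP<-; auto.
Qed.

Lemma flag_of_dart_adj x F (k : 'I_3) :
  flag_of_dart x F -> flag_of_dart (dart_step k x) (adj k F).
Proof.
move=> xF; have [F' xF'] := flag_of_dart_ex (dart_step k x).
by rewrite (adj_uniq prism_gr prism_diamond (flag_of_dart_adjacent xF xF')).
Qed.

Definition dart_walk x (w : word 'I_3) := foldl (fun y l => dart_step l.1 y) x w.

Lemma flag_of_dart_walk x F w : flag_of_dart x F -> flag_of_dart (dart_walk x w) (walk F w).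
Proof. by elim: w x F => //= l w IH x F xF; apply/IH/flag_of_dart_adj. Qed.

Lemma prism_walk w :
  (forall F : flag (prism n), walk F w = F) <-> (forall x, dart_walk x w = x).
Proof.
split=> H => [x|F].
  have [F xF] := flag_of_dart_ex x; have := flag_of_dart_walk w xF.
  by rewrite H => /flag_of_dart_inj; apply.
have [x xF] := dart_of_flag F; have := flag_of_dart_walk w xF.
by rewrite H => /flag_of_dart_uniq; apply.
Qed.
End PrismFlags.

(** * The monodromy group of the prism *)

Section DartGroup.
Import mathcomp.boot.finset.
Local Close Scope classical_set_scope.
Local Open Scope set_scope.
Local Open Scope group_scope.
Variable n : nat.
Hypothesis hn : (3 <= n)%N.

(** Permutations of the coordinates stand for permutations of the flags of the prism, by
[prism_walk]. *)
Definition dart_perm (k : 'I_3) : {perm dart n} := perm (can_inj (@dart_stepK n k)).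
Local Notation r := dart_perm.
Local Notation a := (r o0).
Local Notation b := (r o1).
Local Notation c := (r o2).
Local Notation x := (reflections r).

Lemma dart_permE k y : r k y = dart_step k y. Proof. by rewrite permE. Qed.

Lemma dart_perm_sq k : r k * r k = 1.
Proof. by apply/perm.permP => y; rewrite permM !dart_permE dart_stepK perm1. Qed.

Lemma dart_ac : a * c = c * a.
Proof.
apply/perm.permP => -[[[t s] i] e]; rewrite !permM !dart_permE /dart_step /=.
by elim/ord3_cases: t; rewrite /= ?inordK.
Qed.

Lemma dart_bcb : b * c * b = c * b * c.
Proof.
apply/perm.permP => -[[[t s] i] e]; rewrite !permM !dart_permE /dart_step /=.
by elim/ord3_cases: t; do ![rewrite /= ?inordK //].
Qed.

(** The reflection j exchanges the two n-gons on the type j. On each of the other two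
types it is a reflection along the n-gons, which moves in the direction e for the smaller
of the two colours other than the type and against it for the larger. *)
Lemma dart_reflection (j t : 'I_3) s i e : x j (t, s, i, e) =
  if t == j then (t, ~~ s, i, e)
  else (t, s, other_end i (e (+) (third t j < j)%N), ~~ e).
Proof.
elim/ord3_cases: j; elim/ord3_cases: t; rewrite /reflections /= ?permM !dart_permE /dart_step;
  do ![rewrite /= ?inordK //]; rewrite ?addbF ?addbT ?negbK //;
  by congr (_, _, _, _); apply: val_inj; rewrite /= inordK.
Qed.

(** The type on which x_i exchanges the n-gons is sent to the type 0, on which a does; in
general the first, second and last colour of the ordering are sent to 0, 1, 2. *)
Lemma dart_tau (i k t : 'I_3) s m e : i != k ->
  (tau r i k (t, s, m, e)).1.1.1 = (if t == i then o0
    else if t == k then o2 else o1) :> 'I_3.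
Proof.
elim/ord3_cases: i; elim/ord3_cases: k => // _; elim/ord3_cases: t;
  rewrite /tau /= ?permM ?perm1 ?dart_permE /dart_step; do ![rewrite /= ?inordK //];
  by apply: val_inj; rewrite /= inordK.
Qed.

(** A product of reflections other than x_t neither changes the type t nor exchanges the
n-gons on it. *)
Lemma dart_parab (J : {set 'I_3}) (t : 'I_3) g : t \notin J -> g \in parab x J ->
  forall y : dart n, y.1.1.1 = t -> (g y).1.1 = y.1.1.
Proof.
move=> tJ; move: g; apply: gen_ind => [|g s IH /imsetP[j jJ ->]] y yt; first by rewrite perm1.
rewrite permM; have := IH y yt; case: (g y) => [[[t' s'] i] e] /= E.
rewrite dart_reflection ifN //; move: E yt; case: y => [[[t1 s1] i1] e1] /= [-> _] ->.
by apply: contraNneq tJ => ->.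
Qed.

Lemma dart_parabT g : g \in parab x setT -> forall y : dart n, (g y).1.1.1 = y.1.1.1.
Proof.
move: g; apply: gen_ind => [|g s IH /imsetP[j jJ ->]] y; first by rewrite perm1.
rewrite permM -(IH y); case: (g y) => [[[t' s'] i] e].
by rewrite dart_reflection; case: ifP.
Qed.

(** Exchanging the n-gons on the type j distinguishes x_j from the elements of
[dart_parab]. *)
Lemma dart_indep J j : x j \in parab x J -> j \in J.
Proof.
apply: contraTT => jJ; apply/negP => /(dart_parab jJ)/(_ (j, false, 0%R, false) erefl).
by rewrite dart_reflection eqxx.
Qed.

(** Reflections preserve types, whereas the six elements tau permute the types
differently. *)
Lemma dart_tau_inj i k i' k' : i != k -> i' != k' ->
  tau r i k * (tau r i' k')^-1 \in parab x setT -> i = i' /\ k = k'.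
Proof.
move=> ik ik' /dart_parabT H.
have {}H t : (tau r i k (t, false, 0%R, false)).1.1.1 =
    (if t == i' then o0 else if t == k' then o2 else o1).
  have := H (t, false, 0%R, false); rewrite permM /=.
  set y := tau r i k _; case E : ((tau r i' k')^-1 y) => [[[t' s'] m'] e'] /= <-.
  by rewrite -(dart_tau _ s' m' e' ik') -E permKV.
have ki : (k == i) = false by rewrite eq_sym; apply: negbTE.
have := H i; rewrite dart_tau // eqxx; have [ei _|_] := eqVneq i i'; last by case: ifP.
subst i'; have := H k; rewrite dart_tau // eqxx ki.
by have [->|] := eqVneq k k'.
Qed.

Lemma eval_dart w y : eval r w y = dart_walk y w.
Proof.
rewrite /eval; elim: w y => [|[k e] w IH] y; first by rewrite big_nil perm1.
rewrite big_cons permM IH /=; congr (dart_walk _ w).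
have -> : (if e then (r k)^-1 else r k) = r k.
  by case: e => //; apply: (mulgI (r k)); rewrite mulgV dart_perm_sq.
exact: dart_permE.
Qed.

Lemma eval_dart_eq1 w : eval r w = 1 <-> (forall y : dart n, dart_walk y w = y).
Proof.
split=> [e y|H]; first by rewrite -eval_dart e perm1.
by apply/perm.permP => y; rewrite eval_dart H perm1.
Qed.

(** The group generated by the reflections is the group N whose cosets are the faces of
the cover. *)
Definition prism_cover := coset_face x.

Lemma prism_cover_walk (F : flag prism_cover) w : walk F w = F <-> eval r w = 1.
Proof. exact: coset_walk dart_perm_sq dart_ac dart_bcb dart_indep dart_tau_inj F w. Qed.

Lemma prism_cover_regular : is_regular prism_cover.
Proof. exact: coset_regular dart_perm_sq dart_ac dart_bcb dart_indep dart_tau_inj. Qed.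

Lemma prism_cover_walk_prism (F : flag prism_cover) w :
  walk F w = F <-> forall G : flag (prism n), walk G w = G.
Proof. by rewrite prism_cover_walk eval_dart_eq1 (prism_walk hn). Qed.

Lemma dart_shift_exp (g : {perm dart n}) (sh : 'I_3 -> bool -> 'Z_n) m :
  (forall t s i e, g (t, s, i, e) = (t, s, i + sh t e, e)%R) ->
  forall t s i e, (g ^+ m) (t, s, i, e) = (t, s, i + sh t e *+ m, e)%R.
Proof.
move=> H t s i e; rewrite permX; elim: m => [|m IH]; first by rewrite /= mulr0n addr0.
by rewrite iterS IH H mulrSr addrA.
Qed.

Local Open Scope ring_scope.

Lemma perm_rot (g h : {perm dart n}) y : ((g * h) ^+ 2)%g y = h (g (h (g y))).
Proof. by rewrite expgS expg1 !permM. Qed.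

(** On the type whose n-gons neither factor exchanges, the product moves by two steps
along the n-gon, so its square moves by four. On the two other types the square of the
product is trivial, because one factor is an exchange of the n-gons that commutes with the
other. *)
Lemma dart_rot01 t s i e : ((x o0 * x o1) ^+ 2)%g (t, s, i, e) =
  (t, s, i + (if t == o2 then (if e then - 4 else 4) else 0), e).
Proof.
rewrite perm_rot !dart_reflection; elim/ord3_cases: t; case: e;
  do ![rewrite ?dart_reflection /=]; rewrite ?negbK /other_end /= ?addr0 //;
  congr (_, _, _, _); ring.
Qed.

Lemma dart_rot12 t s i e : ((x o1 * x o2) ^+ 2)%g (t, s, i, e) =
  (t, s, i + (if t == o0 then (if e then - 4 else 4) else 0), e).
Proof.
rewrite perm_rot !dart_reflection; elim/ord3_cases: t; case: e;
  do ![rewrite ?dart_reflection /=]; rewrite ?negbK /other_end /= ?addr0 //;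
  congr (_, _, _, _); ring.
Qed.

Lemma dart_rot20 t s i e : ((x o2 * x o0) ^+ 2)%g (t, s, i, e) =
  (t, s, i + (if t == o1 then (if e then 4 else - 4) else 0), e).
Proof.
rewrite perm_rot !dart_reflection; elim/ord3_cases: t; case: e;
  do ![rewrite ?dart_reflection /=]; rewrite ?negbK /other_end /= ?addr0 //;
  congr (_, _, _, _); ring.
Qed.

(** The turn s moves the type 2 only, where x_2 exchanges the n-gons without moving along
them. *)
Lemma dart_extra : commute (x o2) ((x o0 * x o1) ^+ 2)%g.
Proof.
apply/perm.permP => -[[[t s] i] e]; rewrite (permM (x o2)) (permM _ (x o2)) dart_rot01
  !dart_reflection.
elim/ord3_cases: t; rewrite /= ?dart_rot01 ?dart_reflection /= ?addr0 //.
Qed.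

Lemma Zn_nat_eq0 m : ((m%:R : 'Z_n) == 0) = (n %| m)%N.
Proof.
have n1 : (1 < n)%N by case: n hn => [|[|]].
by rewrite -val_eqE /= val_Zp_nat.
Qed.
End DartGroup.

(** * Groups given by generators and relations *)

Section Evaluation.
Local Open Scope group_scope.
Variables (I : Type) (G : groupType) (g : I -> G).
Implicit Types w v : word I.

Lemma eval_nil : eval g [::] = 1. Proof. exact: big_nil. Qed.
Lemma eval_cat w v : eval g (w ++ v) = eval g w * eval g v. Proof. exact: big_cat. Qed.
Lemma eval_letter i : eval g (letter i) = g i. Proof. exact: big_seq1. Qed.
Lemma eval_wexp w k : eval g (wexp w k) = eval g w ^+ k.
Proof.
rewrite /wexp; elim: k => [|k IH] /=; first by rewrite eval_nil.
by rewrite eval_cat IH expgS.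
Qed.

Definition winv w : word I := rev [seq (l.1, ~~ l.2) | l <- w].

Lemma winv_cons l w : winv (l :: w) = winv w ++ [:: (l.1, ~~ l.2)].
Proof. by rewrite /winv /= rev_cons cats1. Qed.

Lemma eval_winv w : eval g (winv w) = (eval g w)^-1.
Proof.
elim: w => [|[i e] w IH]; first by rewrite eval_nil invg1.
rewrite winv_cons eval_cat IH [in RHS]/eval big_cons invgM; congr (_ * _).
by rewrite /eval big_seq1; case: e; rewrite //= invgK.
Qed.

Variable R : word I -> Prop.

Lemma eval_pres_eq : (forall w, R w -> eval g w = 1) ->
  forall w v, pres_eq R w v -> eval g w = eval g v.
Proof.
move=> Rg w v; elim=> {w v} // [u v w _ -> _ -> //|u u' w w' _ eu _ ew|i e|w /Rg->].
- by rewrite !eval_cat eu ew.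
- by rewrite /eval !big_cons !big_nil mulg1; case: e; rewrite /= ?mulgV ?mulVg.
- by rewrite eval_nil.
Qed.

Lemma pres_winv w : pres_eq R (w ++ winv w) [::].
Proof.
elim: w => [|[i e] w IH]; first exact: pres_refl.
rewrite winv_cons catA cat_cons -cat1s -catA.
have h : pres_eq R ((w ++ winv w) ++ [:: (i, ~~ e)]) ([::] ++ [:: (i, ~~ e)]).
  by apply: pres_cat => //; apply: pres_refl.
apply: pres_trans (pres_cat (pres_refl R [:: (i, e)]) h) _.
exact: pres_cancel.
Qed.

Lemma winvK w : winv (winv w) = w.
Proof.
rewrite /winv map_rev revK -map_comp -[RHS]map_id; apply: eq_map => -[i e] /=.
by rewrite negbK.
Qed.

Lemma pres_winvl w : pres_eq R (winv w ++ w) [::].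
Proof. by rewrite -{2}[w]winvK; apply: pres_winv. Qed.

(** It suffices to compare the words that represent 1. *)
Lemma has_presentation_eq1 : (forall x : G, exists w, eval g w = x) ->
  (forall w, eval g w = 1 <-> pres_eq R w [::]) -> has_presentation g R.
Proof.
move=> onto ker; split=> // w v; split=> [e|].
  have /ker h : eval g (w ++ winv v) = 1 by rewrite eval_cat eval_winv e mulgV.
  have h1 : pres_eq R (w ++ (winv v ++ v)) (w ++ [::]).
    by apply: pres_cat; [apply: pres_refl | apply: pres_winvl].
  rewrite cats0 in h1; apply: pres_trans (pres_sym h1) _; rewrite catA.
  exact: (pres_cat h (pres_refl R v)).
apply: eval_pres_eq => u Ru; apply/ker; exact: pres_rel.
Qed.
End Evaluation.

Section PresentedGroup.
Variables (I : choiceType) (R : word I -> Prop).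
Local Open Scope quotient_scope.

Let req (w v : seq (I * bool)) : bool := `[< pres_eq R w v >].

Let req_refl : reflexive req. Proof. by move=> w; apply/asboolP; apply: pres_refl. Qed.
Let req_sym : symmetric req.
Proof. by move=> w v; apply/asboolP/asboolP; apply: pres_sym. Qed.
Let req_trans : transitive req.
Proof. by move=> v w u /asboolP wv /asboolP vu; apply/asboolP; apply: pres_trans wv vu. Qed.

Canonical pres_equiv := EquivRel req req_refl req_sym req_trans.

(** The group of words modulo the relators, built in order to carry out computations from
the relators in a group rather than with words. *)
Definition presented := {eq_quot pres_equiv}.
HB.instance Definition _ := Choice.on presented.

Definition pres_class (w : word I) : presented := \pi_presented w.

Lemma pres_classP w v : pres_class w = pres_class v <-> pres_eq R w v.
Proof.
split=> [/eqmodP/asboolP//|h]; apply/eqmodP; exact/asboolP.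
Qed.

Lemma pres_class_repr (x : presented) : pres_class (repr x) = x.
Proof. exact: reprK. Qed.

Definition pres_mul (x y : presented) := pres_class (repr x ++ repr y).
Definition pres_inv (x : presented) := pres_class (winv (repr x)).
Definition pres_one := pres_class [::].

Lemma pres_class_cat w v : pres_class (w ++ v) = pres_mul (pres_class w) (pres_class v).
Proof.
by apply/pres_classP; apply: pres_cat; apply: pres_sym; apply/pres_classP; rewrite
  pres_class_repr.
Qed.

Lemma pres_mulA : associative pres_mul.
Proof.
move=> x y z; rewrite -[x]pres_class_repr -[y]pres_class_repr -[z]pres_class_repr.
by rewrite -!pres_class_cat catA.
Qed.
Lemma pres_mul1 : left_id pres_one pres_mul.
Proof. by move=> x; rewrite -[x]pres_class_repr -pres_class_cat. Qed.
Lemma pres_mulr1 : right_id pres_one pres_mul.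
Proof. by move=> x; rewrite -[x]pres_class_repr -pres_class_cat cats0. Qed.
Lemma pres_mulV : left_inverse pres_one pres_inv pres_mul.
Proof.
move=> x; rewrite -{2}[x]pres_class_repr -pres_class_cat.
by apply/pres_classP/pres_winvl.
Qed.
Lemma pres_mulrV : right_inverse pres_one pres_inv pres_mul.
Proof.
move=> x; rewrite -{1}[x]pres_class_repr -pres_class_cat.
by apply/pres_classP/pres_winv.
Qed.

HB.instance Definition _ := isGroup.Build presented
  pres_mulA pres_mul1 pres_mulr1 pres_mulV pres_mulrV.

Definition pres_gen (i : I) : presented := pres_class (letter i).

Lemma eval_pres_gen w : eval pres_gen w = pres_class w.
Proof.
elim: w => [|[i e] w IH]; first exact: big_nil.
rewrite -cat1s eval_cat IH pres_class_cat; congr (pres_mul _ _).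
rewrite /eval big_seq1; case: e => //=; apply: (mulgI (pres_gen i)); rewrite mulgV.
by rewrite [RHS](esym (pres_class_cat _ _)); apply/esym/pres_classP; apply: pres_cancel.
Qed.

Lemma eval_pres_eq1 w : eval pres_gen w = 1%g <-> pres_eq R w [::].
Proof. by rewrite eval_pres_gen; apply: pres_classP. Qed.
End PresentedGroup.

(** * Normal forms in the presented group *)

Section ThreeInvolutions.
Local Open Scope group_scope.
Variables (G : groupType) (x y z : G) (L : nat).
Hypotheses (xx : x * x = 1) (yy : y * y = 1) (zz : z * z = 1).
Local Notation s := ((x * y) ^+ 2).
Local Notation t := ((y * z) ^+ 2).
Local Notation u := ((z * x) ^+ 2).
Hypotheses (zs : commute z s) (xt : commute x t) (yu : commute y u).
Hypotheses (L0 : 0 < L) (sL : s ^+ L = 1) (tL : t ^+ L = 1) (uL : u ^+ L = 1).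

Lemma invol_inv (v : G) : v * v = 1 -> v^-1 = v.
Proof. by move=> vv; apply: (mulgI v); rewrite mulgV vv. Qed.

Lemma conj_rot (v w : G) : v * v = 1 -> w * w = 1 ->
  ((v * w) ^+ 2) ^ v = ((v * w) ^+ 2)^-1 /\ ((v * w) ^+ 2) ^ w = ((v * w) ^+ 2)^-1.
Proof.
move=> vv ww; have vK := invol_inv vv; have wK := invol_inv ww.
rewrite expgS expg1 !conjgE !invgM vK wK !mulgA vv !mul1g; split=> //.
by rewrite -!mulgA ww mulg1.
Qed.

Lemma conj_comm (v g : G) : commute v g -> g ^ v = g.
Proof. by move=> vg; rewrite conjgE -vg mulKg. Qed.

Lemma comm_conj (v g : G) : g ^ v = g -> commute v g.
Proof. by move=> e; rewrite /commute [RHS]conjgC e. Qed.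

Let sx : s ^ x = s^-1. Proof. by case: (conj_rot xx yy). Qed.
Let sy : s ^ y = s^-1. Proof. by case: (conj_rot xx yy). Qed.
Let sz : s ^ z = s. Proof. exact: conj_comm. Qed.
Let tx : t ^ x = t. Proof. exact: conj_comm. Qed.
Let ty : t ^ y = t^-1. Proof. by case: (conj_rot yy zz). Qed.
Let tz : t ^ z = t^-1. Proof. by case: (conj_rot yy zz). Qed.
Let ux : u ^ x = u^-1. Proof. by case: (conj_rot zz xx). Qed.
Let uy : u ^ y = u. Proof. exact: conj_comm. Qed.
Let uz : u ^ z = u^-1. Proof. by case: (conj_rot zz xx). Qed.

Let st : commute s t.
Proof. by apply: comm_conj; rewrite expgS expg1 !conjgM tx ty conjVg tx conjVg ty invgK. Qed.
Let su : commute s u.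
Proof. by apply: comm_conj; rewrite expgS expg1 !conjgM ux conjVg uy conjVg ux invgK uy. Qed.
Let tu : commute t u.
Proof. by apply: comm_conj; rewrite expgS expg1 !conjgM uy uz conjVg uy conjVg uz invgK. Qed.

(** The subgroup generated by s, t and u. Natural exponents suffice because s, t, u have
finite order. *)
Definition rotations (g : G) := exists i j k, g = s ^+ i * t ^+ j * u ^+ k.

Lemma rotationsM g h : rotations g -> rotations h -> rotations (g * h).
Proof.
move=> [i [j [k ->]]] [i' [j' [k' ->]]]; exists (i + i')%N, (j + j')%N, (k + k')%N.
have cu : u ^+ k * (s ^+ i' * t ^+ j') = s ^+ i' * t ^+ j' * u ^+ k.
  by apply: commuteM; apply: commuteX2; apply: commute_sym.
have ct : t ^+ j * s ^+ i' = s ^+ i' * t ^+ j.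
  by apply: commuteX2; apply: commute_sym.
rewrite !expgnDr -[s ^+ i * t ^+ j * u ^+ k * _]mulgA [u ^+ k * _]mulgA cu.
by rewrite !mulgA -(mulgA (s ^+ i) (t ^+ j)) ct mulgA.
Qed.

Lemma rotations1 : rotations 1.
Proof. by exists 0%N, 0%N, 0%N; rewrite !expg0 !mulg1. Qed.

Lemma rotationsX g m : rotations g -> rotations (g ^+ m).
Proof.
move=> gr; elim: m => [|m IH]; first by rewrite expg0; apply: rotations1.
by rewrite expgS; apply: rotationsM.
Qed.

Let rs : rotations s. Proof. by exists 1%N, 0%N, 0%N; rewrite !expg0 !mulg1. Qed.
Let rt : rotations t. Proof. by exists 0%N, 1%N, 0%N; rewrite !expg0 mulg1 mul1g. Qed.
Let ru : rotations u. Proof. by exists 0%N, 0%N, 1%N; rewrite !expg0 !mul1g. Qed.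

Lemma inv_exp (g : G) : g ^+ L = 1 -> g^-1 = g ^+ L.-1.
Proof. by move=> gL; apply: (mulgI g); rewrite mulgV -expgS prednK. Qed.

Let rsV : rotations s^-1. Proof. by rewrite inv_exp //; apply: rotationsX. Qed.
Let rtV : rotations t^-1. Proof. by rewrite inv_exp //; apply: rotationsX. Qed.
Let ruV : rotations u^-1. Proof. by rewrite inv_exp //; apply: rotationsX. Qed.

(** Conjugation is by the inverse of v because moving g to the left past v produces it. *)
Definition normalises (v : G) := forall g, rotations g -> rotations (g ^ v^-1).

Let norm_of v : v * v = 1 -> rotations (s ^ v) -> rotations (t ^ v) -> rotations (u ^ v) ->
  normalises v.
Proof.
move=> vv rs' rt' ru' g [i [j [k ->]]]; rewrite (invol_inv vv) !conjMg ![(_ ^+ i) ^ _]conjXg.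
by rewrite ![(_ ^+ j) ^ _]conjXg ![(_ ^+ k) ^ _]conjXg; do !apply: rotationsM; apply: rotationsX.
Qed.

Let nx : normalises x. Proof. by apply: norm_of => //; rewrite ?sx ?tx ?ux. Qed.
Let ny : normalises y. Proof. by apply: norm_of => //; rewrite ?sy ?ty ?uy. Qed.
Let nz : normalises z. Proof. by apply: norm_of => //; rewrite ?sz ?tz ?uz. Qed.

Let norm1 : normalises 1. Proof. by move=> g; rewrite invg1 conjg1. Qed.
Let normM v w : normalises v -> normalises w -> normalises (v * w).
Proof. by move=> nv nw g rg; rewrite invgM conjgM; apply/nv/nw. Qed.
Let norm_bool v (e : bool) : normalises v -> normalises (v ^+ e).
Proof. by case: e. Qed.

(** Modulo the rotations the three involutions commute, because yx = s^-1 xy, zy = t^-1 yz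
and zx = u xz. *)
Definition congr_rot g h := exists2 k, rotations k & g = k * h.

Let cr_refl g : congr_rot g g.
Proof. by exists 1; [apply: rotations1 | rewrite mul1g]. Qed.
Let cr_trans g h k : congr_rot g h -> congr_rot h k -> congr_rot g k.
Proof. by move=> [a ra ->] [b rb ->]; exists (a * b); [apply: rotationsM | rewrite mulgA]. Qed.
Let cr_mulr g h k : congr_rot g h -> congr_rot (g * k) (h * k).
Proof. by move=> [a ra ->]; exists a; rewrite ?mulgA. Qed.
Let cr_mull v g h : normalises v -> congr_rot g h -> congr_rot (v * g) (v * h).
Proof. by move=> nv [a ra ->]; exists (a ^ v^-1); [apply: nv | rewrite mulgA (conjgCV v a)
  mulgA]. Qed.

Let cyx : congr_rot (y * x) (x * y).
Proof.
exists s^-1 => //; rewrite expgS expg1 !invgM (invol_inv xx) (invol_inv yy) -!mulgA.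
by rewrite [x * (x * y)]mulgA xx mul1g yy mulg1.
Qed.
Let czy : congr_rot (z * y) (y * z).
Proof.
exists t^-1 => //; rewrite expgS expg1 !invgM (invol_inv zz) (invol_inv yy) -!mulgA.
by rewrite [y * (y * z)]mulgA yy mul1g zz mulg1.
Qed.
Let czx : congr_rot (z * x) (x * z).
Proof.
exists u => //; rewrite expgS expg1 -!mulgA.
by rewrite [x * (x * z)]mulgA xx mul1g zz mulg1.
Qed.

Let swap (v w : G) (e : bool) : congr_rot (w * v) (v * w) -> congr_rot (w ^+ e * v) (v * w ^+ e).
Proof. by case: e => //= _; rewrite expg0 mul1g mulg1; apply: cr_refl. Qed.

Let flip (v : G) (e : bool) : v * v = 1 -> v ^+ e * v = v ^+ (~~ e).
Proof. by case: e => //= _; rewrite expg0 mul1g. Qed.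

Definition reduced g := exists e f h : bool, congr_rot g (x ^+ e * y ^+ f * z ^+ h).

Lemma reduced1 : reduced 1.
Proof. by exists false, false, false; rewrite /= !expg0 !mulg1. Qed.

Lemma reduced_z g : reduced g -> reduced (g * z).
Proof.
move=> [e [f [h H]]]; exists e, f, (~~ h).
by have := cr_mulr z H; rewrite -mulgA flip.
Qed.

Lemma reduced_y g : reduced g -> reduced (g * y).
Proof.
move=> [e [f [h H]]]; exists e, (~~ f), h; apply: cr_trans (cr_mulr y H) _.
rewrite -(flip f yy) -2!mulgA -2!mulgA; apply: cr_mull; first exact: norm_bool.
by apply: cr_mull; [apply: norm_bool | apply: swap].
Qed.

(** The new factor x is moved to the left past z and then past y, up to rotations. *)
Lemma reduced_x g : reduced g -> reduced (g * x).
Proof.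
move=> [e [f [h H]]]; exists (~~ e), f, h; apply: cr_trans (cr_mulr x H) _.
rewrite -(flip e xx) -!mulgA; apply: cr_mull; first exact: norm_bool.
apply: cr_trans (_ : congr_rot _ (y ^+ f * (x * z ^+ h))) _.
  by apply: cr_mull; [apply: norm_bool | apply: swap].
by rewrite !mulgA; apply: cr_mulr; apply: swap.
Qed.
End ThreeInvolutions.

Section NormalForm.
Local Open Scope group_scope.
Variables (G : groupType) (r : 'I_3 -> G) (L : nat).
Local Notation a := (r o0).
Local Notation b := (r o1).
Local Notation c := (r o2).
Hypothesis rr : forall j, r j * r j = 1.
Hypothesis ac : a * c = c * a.
Hypothesis bcb : b * c * b = c * b * c.
Local Notation x := (reflections r).
Local Notation s := ((x o0 * x o1) ^+ 2).
Local Notation t := ((x o1 * x o2) ^+ 2).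
Local Notation u := ((x o2 * x o0) ^+ 2).

Let rV j : (r j)^-1 = r j. Proof. exact: invol_inv. Qed.
Let rK j g : g * r j * r j = g. Proof. by rewrite -mulgA rr mulg1. Qed.

Let acg g : g * c * a = g * a * c. Proof. by rewrite -!mulgA ac. Qed.
Let cbcg g : g * c * b * c = g * b * c * b.
Proof. by rewrite -!mulgA; congr (g * _); rewrite !mulgA bcb. Qed.

Lemma refl_conj_b : [/\ x o0 ^ b = x o1, x o1 ^ b = x o0 & x o2 ^ b = x o2].
Proof.
rewrite !conjgE rV /reflections /= !mulgA; split=> //; first by rewrite rr mul1g rK.
by rewrite bcb acg cbcg rK.
Qed.

Lemma refl_conj_c : [/\ x o0 ^ c = x o0, x o1 ^ c = x o2 & x o2 ^ c = x o1].
Proof.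
rewrite !conjgE rV /reflections /= !mulgA; split=> //; first by rewrite -ac rK.
by rewrite rr mul1g rK.
Qed.

Lemma rot_inv (v w : G) : v * v = 1 -> w * w = 1 -> ((v * w) ^+ 2)^-1 = (w * v) ^+ 2.
Proof. by move=> vv ww; rewrite !expg2 !invgM (invol_inv vv) (invol_inv ww). Qed.

Let xx j : x j * x j = 1. Proof. exact: reflections_sq. Qed.


Let a0 : a = x o0. Proof. by []. Qed.
Let abE : (a * b) ^+ 2 = x o0 * x o1.
Proof. by rewrite expg2 /reflections /= !mulgA. Qed.

Lemma ab_sq : s = (a * b) ^+ 4.
Proof. by rewrite (_ : 4 = 2 * 2)%N // expgnA abE. Qed.

Let conj_sq (p q v : G) : ((p * q) ^+ 2) ^ v = (p ^ v * q ^ v) ^+ 2.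
Proof. by rewrite conjXg conjMg. Qed.
Let conj_mul5 (p1 p2 p3 p4 p5 v : G) :
  (p1 * p2 * p3 * p4 * p5) ^ v = p1 ^ v * p2 ^ v * p3 ^ v * p4 ^ v * p5 ^ v.
Proof. by rewrite !conjMg. Qed.

(** The rotations s, u, t are conjugate up to inversion. *)
Lemma rot_conj : s ^ c = u^-1 /\ u ^ b = t^-1.
Proof.
have [b0 b1 b2] := refl_conj_b; have [c0 c1 c2] := refl_conj_c.
by rewrite !conj_sq b0 b2 c0 c1 !rot_inv.
Qed.

Let extra_calc (p q v : G) : p * p = 1 -> q * q = 1 ->
  p * v * p * q * p * (q * v * q * p * q) = (v * (p * q) ^+ 2 * v * ((p * q) ^+ 2)^-1) ^ p.
Proof.
move=> pp qq; rewrite rot_inv // !expg2 conjgE (invol_inv pp) -!mulgA.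
by rewrite pp mulg1.
Qed.

(** Since c (ab)^2 c = x_0 x_2 and (ab)^3 = x_0 x_1 x_0 b, the extra relator is the square
of V b with V = x_0 x_2 x_0 x_1 x_0, that is V V^b, and V^b = x_1 x_2 x_1 x_0 x_1. Up to
conjugation by x_0 this is the commutator of x_2 and s. *)
Lemma extra_relator_commute : eval r extra_relator = 1 <-> commute (x o2) s.
Proof.
have e : eval r extra_relator = (c * (x o0 * x o1) * c * (x o0 * x o1 * (a * b))) ^+ 2.
  rewrite eval_wexp (eval_cat r word_c) (eval_cat r (wexp (word_a ++ word_b) 2)).
  rewrite (eval_cat r word_c) !(eval_wexp r (word_a ++ word_b)) (eval_cat r word_a) !eval_letter.
  by rewrite (expgSr _ 2) abE !mulgA.
have [b0 b1 b2] := refl_conj_b; have [c0 c1 c2] := refl_conj_c.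
have cE : c * (x o0 * x o1) * c = x o0 * x o2.
  by have := conjMg (x o0) (x o1) c; rewrite c0 c1 conjgE rV [c * (_ * c)]mulgA.
pose V := x o0 * x o2 * x o0 * x o1 * x o0.
have VE : V ^ b = x o1 * x o2 * x o1 * x o0 * x o1 by rewrite conj_mul5 b0 b1 b2.
have {}e : eval r extra_relator = (x o2 * s * x o2 * s^-1) ^ x o0.
  rewrite e cE (_ : _ * (_ * (a * b)) = V * b); last by rewrite a0 /V !mulgA.
  have -> : (V * b) ^+ 2 = V * V ^ b by rewrite expg2 conjgE rV !mulgA.
  by rewrite VE extra_calc.
rewrite e; split=> [/eqP|cz].
  rewrite conjg_eq1 => /eqP E; apply: (mulIg (x o2)); apply: (mulIg s^-1).
  by rewrite E -[s * _ * _]mulgA xx mulg1 mulgV.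
by rewrite cz -(mulgA s) xx mulg1 mulgV conj1g.
Qed.

Hypothesis x2s : commute (x o2) s.
Hypotheses (L0 : (0 < L)%N) (abL : (a * b) ^+ L = 1).

Let x1u : commute (x o1) u.
Proof.
have [c0 c1 c2] := refl_conj_c; have [sc _] := rot_conj.
have : (x o2 * s) ^ c = (s * x o2) ^ c by rewrite x2s.
rewrite (conjMg (x o2)) (conjMg s) c2 sc => h.
by rewrite -[u]invgK; apply: commuteV; exact: h.
Qed.

Let x0t : commute (x o0) t.
Proof.
have [b0 b1 b2] := refl_conj_b; have [_ ub] := rot_conj.
have : (x o1 * u) ^ b = (u * x o1) ^ b by rewrite x1u.
rewrite (conjMg (x o1)) (conjMg u) b1 ub => h.
by rewrite -[t]invgK; apply: commuteV; exact: h.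
Qed.

Lemma rot_exp m : (a * b) ^+ (4 * m) = 1 -> [/\ s ^+ m = 1, t ^+ m = 1 & u ^+ m = 1].
Proof.
move=> abm; have sm : s ^+ m = 1 by rewrite ab_sq -expgnA.
have [sc ub] := rot_conj.
have um : u ^+ m = 1.
  apply: invg_inj; rewrite -expVgn -sc -conjXg sm conj1g invg1 //.
have tm : t ^+ m = 1.
  apply: invg_inj; rewrite -expVgn -ub -conjXg um conj1g invg1 //.
by split.
Qed.

(** Multiplying on the right by b or c changes the last factor only. Multiplying by a
replaces tau by x_i tau, so [reduced_x] and its companions apply. *)
Lemma normal_form w : exists m1 m2 m3 (e f h : bool) (i k : 'I_3), i != k /\
  eval r w = s ^+ m1 * t ^+ m2 * u ^+ m3 * (x o0 ^+ e * x o1 ^+ f * x o2 ^+ h) * tau r i k.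
Proof.
have [sL tL uL] : [/\ s ^+ L = 1, t ^+ L = 1 & u ^+ L = 1].
  by apply: rot_exp; rewrite mulnC expgnA abL expg1n.
suff [g [i [k [ik [e [f [h [_ [m1 [m2 [m3 ->]]] ->]]]] ->]]]] : exists g i k, [/\ i != k,
    reduced (x o0) (x o1) (x o2) g & eval r w = g * tau r i k].
  by exists m1, m2, m3, e, f, h, i, k.
have : exists g i k, [/\ i != k, reduced (x o0) (x o1) (x o2) g & 1 = g * tau r i k].
  by exists 1, o0, o2; split=> //; [apply: reduced1 | rewrite mul1g].
rewrite -[eval r w]mul1g; move: (1 : G).
elim: w => [|[j e] w IH] p [g [i [k [ik gr ->]]]].
  by rewrite eval_nil mulg1; exists g, i, k.
rewrite /eval big_cons /= mulgA; apply: IH.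
have -> : (if e then (r j)^-1 else r j) = r j by case: e; rewrite ?rV.
have [t1 t2] := thirdP ik; rewrite -mulgA; elim/ord3_cases: j.
- exists (g * x i), i, k; split=> //; last by rewrite tau_a // mulgA.
  elim/ord3_cases: i {ik t1 t2}; [exact: (reduced_x (L := L))|exact: (reduced_y (L :=
    L))|exact: reduced_z].
- by exists g, (third i k), k; split=> //; rewrite tau_b.
- by exists g, i, (third i k); rewrite eq_sym; split=> //; rewrite tau_c.
Qed.
End NormalForm.

(** * The relators in the monodromy group *)

Section Relations.
Local Open Scope group_scope.
Variables (G : groupType) (r : 'I_3 -> G) (L : nat).
Local Notation a := (r o0).
Local Notation b := (r o1).
Local Notation c := (r o2).
Local Notation R := (fun w => w \in rcons (coxeter_relators L 3) extra_relator).

Lemma eval_relators : (forall w, R w -> eval r w = 1) <->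
  [/\ a ^+ 2 = 1, b ^+ 2 = 1, c ^+ 2 = 1, (a * c) ^+ 2 = 1 &
     [/\ (a * b) ^+ L = 1, (b * c) ^+ 3 = 1 & eval r extra_relator = 1]].
Proof.
have e1 w k : eval r (wexp w k) = eval r w ^+ k by exact: eval_wexp.
have e2 w v k : eval r (wexp (w ++ v) k) = (eval r w * eval r v) ^+ k.
  by rewrite e1 (eval_cat r w).
have ea := eval_letter r o0; have eb := eval_letter r o1; have ec := eval_letter r o2.
split=> [H|[aa bb cc acac [abL bcbc ex]] w].
  have mem w : w \in rcons (coxeter_relators L 3) extra_relator -> eval r w = 1 by exact: H.
  split; rewrite -?ea -?eb -?ec -?e2 -?e1; try split; rewrite -?e2;
    by apply: mem; rewrite mem_rcons !inE eqxx ?orbT.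
rewrite mem_rcons !inE => /orP[/eqP->//|].
by do ![case/orP]; move=> /eqP->; rewrite ?e2 ?e1 ?ea ?eb ?ec.
Qed.

Lemma relations_basic : (forall w, R w -> eval r w = 1) ->
  [/\ forall j, r j * r j = 1, a * c = c * a, b * c * b = c * b * c,
      (a * b) ^+ L = 1 & commute (reflections r o2) ((reflections r o0 * reflections r o1) ^+ 2)].
Proof.
move=> /eval_relators[aa bb cc acac [abL bcbc ex]].
have rr j : r j * r j = 1 by elim/ord3_cases: j; rewrite -expg2.
have rV j : (r j)^-1 = r j by exact: invol_inv.
have ac : a * c = c * a.
  by apply: (mulgI (a * c)); rewrite -expg2 acac -!mulgA [c * (c * a)]mulgA rr mul1g rr.
have bcb : b * c * b = c * b * c.
  have /mulg1_eq <- : c * b * c * (b * c * b) = 1.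
    by apply: (mulgI b); rewrite mulg1 -[RHS]mul1g -bcbc !expgS expg0 mulg1 !mulgA.
  by rewrite !invMg !rV mulgA.
split=> //; exact/(extra_relator_commute rr ac bcb).
Qed.

Definition reflection_word (j : 'I_3) : word 'I_3 :=
  match val j with
  | 0 => word_a
  | 1 => word_b ++ word_a ++ word_b
  | _ => word_c ++ word_b ++ word_a ++ word_b ++ word_c
  end.

Definition tau_word (i k : 'I_3) : word 'I_3 :=
  match val i, val k with
  | 0, 1 => word_c | 1, 2 => word_b | 1, 0 => word_b ++ word_c | 2, 1 => word_c ++ word_b
  | 2, 0 => word_b ++ word_c ++ word_b | _, _ => [::]
  end.

Lemma eval_reflection_word j : eval r (reflection_word j) = reflections r j.
Proof. by elim/ord3_cases: j; rewrite /eval /= ?big_cons big_nil /= mulg1 ?mulgA. Qed.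

Lemma eval_tau_word i k : eval r (tau_word i k) = tau r i k.
Proof.
by elim/ord3_cases: i; elim/ord3_cases: k;
  rewrite /eval /= ?big_cons big_nil /= ?mulg1 ?mulgA.
Qed.

Definition rot_word i j m : word 'I_3 := wexp (wexp (reflection_word i ++ reflection_word j) 2) m.

(** Spelling the normal form as a word makes it an element of both the presented group and
the group of permutations. *)
Definition normal_word m1 m2 m3 (e f h : bool) i k : word 'I_3 :=
  (rot_word o0 o1 m1 ++ rot_word o1 o2 m2 ++ rot_word o2 o0 m3) ++
  (wexp (reflection_word o0) e ++ wexp (reflection_word o1) f ++ wexp (reflection_word o2) h) ++
  tau_word i k.

Lemma eval_normal_word m1 m2 m3 (e f h : bool) i k :
  eval r (normal_word m1 m2 m3 e f h i k) =
  ((reflections r o0 * reflections r o1) ^+ 2) ^+ m1 *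
  ((reflections r o1 * reflections r o2) ^+ 2) ^+ m2 *
  ((reflections r o2 * reflections r o0) ^+ 2) ^+ m3 *
  (reflections r o0 ^+ e * reflections r o1 ^+ f * reflections r o2 ^+ h) * tau r i k.
Proof.
have rot i' j m : eval r (rot_word i' j m) = ((reflections r i' * reflections r j) ^+ 2) ^+ m.
  by rewrite !eval_wexp eval_cat !eval_reflection_word.
have ref j (b' : bool) : eval r (wexp (reflection_word j) b') = reflections r j ^+ b'.
  by rewrite eval_wexp eval_reflection_word.
rewrite /normal_word !(eval_cat r (_ ++ _)) !(eval_cat r (rot_word _ _ _)) !rot.
by rewrite !(eval_cat r (wexp _ _)) !ref eval_tau_word !mulgA.
Qed.
End Relations.

Section PrismPresentation.
Local Open Scope group_scope.
Variable n : nat.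
Hypothesis hn : (3 <= n)%N.
Local Notation L := (lcmn 4 n).
Local Notation r := (@dart_perm n).
Local Notation x := (reflections r).
Local Notation R := (fun w => w \in rcons (coxeter_relators L 3) extra_relator).
Local Notation s := ((x o0 * x o1) ^+ 2).
Local Notation t := ((x o1 * x o2) ^+ 2).
Local Notation u := ((x o2 * x o0) ^+ 2).

Lemma dart_s_exp m (t0 : 'I_3) b i e : (s ^+ m) (t0, b, i, e) =
  (t0, b, i + (if t0 == o2 then (if e then - 4 else 4) else 0) *+ m, e)%R.
Proof.
exact: (@dart_shift_exp n _ (fun t0 e => if t0 == o2 then (if e then - 4 else 4) else 0)%R m
  (@dart_rot01 n)).
Qed.

Lemma dart_t_exp m (t0 : 'I_3) b i e : (t ^+ m) (t0, b, i, e) =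
  (t0, b, i + (if t0 == o0 then (if e then - 4 else 4) else 0) *+ m, e)%R.
Proof.
exact: (@dart_shift_exp n _ (fun t0 e => if t0 == o0 then (if e then - 4 else 4) else 0)%R m
  (@dart_rot12 n)).
Qed.

Lemma dart_u_exp m (t0 : 'I_3) b i e : (u ^+ m) (t0, b, i, e) =
  (t0, b, i + (if t0 == o1 then (if e then 4 else - 4) else 0) *+ m, e)%R.
Proof.
exact: (@dart_shift_exp n _ (fun t0 e => if t0 == o1 then (if e then 4 else - 4) else 0)%R m
  (@dart_rot20 n)).
Qed.

Lemma four_mul m : ((4 : 'Z_n) *+ m == 0)%R = (n %| 4 * m)%N.
Proof. by rewrite -Zn_nat_eq0 // mulrnA. Qed.

Lemma dart_relators w : R w -> eval r w = 1.
Proof.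
move: w; apply/eval_relators.
have rr := @dart_perm_sq n; have ac := dart_ac n; have bcb := dart_bcb n.
split; rewrite ?expg2 //; first by rewrite {2}ac -mulgA (mulgA (r o2)) rr mul1g rr.
split; last exact/(extra_relator_commute rr ac bcb)/dart_extra.
  have [q Lq] : exists q, L = (4 * q)%N by exists (L %/ 4)%N; rewrite mulnC divnK // dvdn_lcml.
  have nq : ((4 : 'Z_n) *+ q)%R = 0%R by apply/eqP; rewrite four_mul -Lq dvdn_lcmr.
  rewrite Lq expgnA -(ab_sq r); apply/perm.permP => -[[[t0 b] i] e].
  rewrite dart_s_exp perm1; congr (_, _, _, _).
  by case: ifP; rewrite ?mul0rn ?addr0 //; case: e; rewrite ?mulNrn nq ?oppr0 addr0.
rewrite expgS expg2 -!mulgA (mulgA (r o1)) (mulgA (r o1 * r o2)) bcb.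
by rewrite -!mulgA (mulgA (r o2) (r o2)) rr mul1g (mulgA (r o1)) rr mul1g rr.
Qed.

(** The image of a flag of type t0 shows one parameter at a time: its type determines tau,
its n-gon determines which of e, f, h are true, and its position along the n-gon
determines m1, m2, m3 modulo n / gcd(n, 4). *)
Lemma dart_normal m1 m2 m3 (e f h : bool) (i k : 'I_3) : i != k ->
  s ^+ m1 * t ^+ m2 * u ^+ m3 * (x o0 ^+ e * x o1 ^+ f * x o2 ^+ h) * tau r i k = 1 ->
  [/\ i = o0 /\ k = o2, [/\ e = false, f = false & h = false] &
      [/\ n %| 4 * m1, n %| 4 * m2 & n %| 4 * m3]]%N.
Proof.
move=> ik; set g := s ^+ m1 * _ * _; set p := x o0 ^+ e * _ * _ => E.
pose base t0 : dart n := (t0, false, 0%R, false).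
have gE t0 : g (base t0) = (t0, false, (if t0 == o2 then 4 *+ m1 else
    if t0 == o0 then 4 *+ m2 else (- 4) *+ m3)%R, false).
  rewrite /g (permM (_ * _)) (permM (s ^+ m1)) dart_s_exp dart_t_exp dart_u_exp.
  by congr (_, _, _, _); elim/ord3_cases: t0; rewrite /= ?mul0rn ?addr0 ?add0r.
have refl_bool (j : 'I_3) (d : bool) (y : dart n) :
    ((x j ^+ d) y).1.1 = (y.1.1.1, y.1.1.2 (+) (d && (y.1.1.1 == j))).
  case: y => [[[t0 b] i0] e0]; case: d; last by rewrite expg0 perm1 /= addbF.
  rewrite expg1 dart_reflection /=; case: ifP => _ /=; [by rewrite addbT|by rewrite addbF].
have pE t0 : (p (g (base t0))).1.1 =
    (t0, (e && (t0 == o0)) (+) (f && (t0 == o1)) (+) (h && (t0 == o2))).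
  by rewrite /p (permM (_ * _)) (permM (x o0 ^+ e)) !refl_bool gE.
have Et t0 : tau r i k (p (g (base t0))) = base t0.
  by rewrite -[RHS]perm1 -E (permM (g * p)) (permM g).
have types t0 : t0 = (if t0 == i then o0 else if t0 == k then o2 else o1) :> 'I_3.
  have := congr1 (fun y : dart n => y.1.1.1) (Et t0); have := pE t0.
  by case: (p _) => [[[t1 b1] i1] e1] /= [-> _]; rewrite dart_tau.
have i0 : i = o0 by have := types i; rewrite eqxx.
have k2 : k = o2 by have := types k; rewrite eqxx eq_sym (negbTE ik).
have tau1 : tau r i k = 1 by rewrite i0 k2.
have sides t0 : (e && (t0 == o0)) (+) (f && (t0 == o1)) (+) (h && (t0 == o2)) = false.
  have := congr1 (fun y : dart n => y.1.1.2) (Et t0).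
  by rewrite tau1 perm1 (pE t0).
have e0 : e = false by have := sides o0; rewrite /= andbT !andbF !addbF.
have f0 : f = false by have := sides o1; rewrite /= andbT !andbF !addbF.
have h0 : h = false by have := sides o2; rewrite /= andbT !andbF.
have p1 : p = 1 by rewrite /p e0 f0 h0 !expg0 !mulg1.
split=> //; have fix_g t0 : g (base t0) = base t0 by have := Et t0; rewrite p1 tau1 !perm1.
split; rewrite -four_mul; apply/eqP.
- by have := fix_g o2; rewrite gE /= => -[].
- by have := fix_g o0; rewrite gE /= => -[].
- have := fix_g o1; rewrite gE /= => -[]; rewrite mulNrn => /eqP.
  by rewrite oppr_eq0 => /eqP.
Qed.

(** A word that acts trivially has a normal form with trivial parameters, and the
remaining powers of s, t, u vanish by (ab)^lcm(4, n) = 1. *)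
Lemma prism_presentation w : eval r w = 1 <-> pres_eq R w [::].
Proof.
split=> [w1|]; last by move=> /(eval_pres_eq dart_relators) ->; apply: eval_nil.
pose q := @pres_gen 'I_3 R.
have qR v : R v -> eval q v = 1 by move=> Rv; apply/eval_pres_eq1; apply: pres_rel.
have [rr ac bcb abL x2s] := relations_basic qR.
have L0 : (0 < L)%N by rewrite lcmn_gt0 /= (leq_trans _ hn).
have [m1 [m2 [m3 [e [f [h [i [k [ik nf]]]]]]]]] := normal_form rr ac bcb x2s L0 abL w.
rewrite -eval_normal_word in nf.
have : pres_eq R w (normal_word m1 m2 m3 e f h i k).
  by apply/pres_classP; rewrite -!eval_pres_gen.
move=> /(eval_pres_eq dart_relators); rewrite w1 eval_normal_word => /esym.
move=> /(dart_normal ik)[[i0 k2] [e0 f0 h0] [d1 d2 d3]].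
have rot m : (n %| 4 * m)%N ->
    [/\ ((reflections q o0 * reflections q o1) ^+ 2) ^+ m = 1,
        ((reflections q o1 * reflections q o2) ^+ 2) ^+ m = 1 &
        ((reflections q o2 * reflections q o0) ^+ 2) ^+ m = 1].
  move=> nm; apply: (rot_exp rr ac bcb).
  have /dvdnP[v ->] : (L %| 4 * m)%N by rewrite dvdn_lcm nm dvdn_mulr.
  by rewrite mulnC expgnA abL expg1n.
apply/eval_pres_eq1; rewrite nf eval_normal_word e0 f0 h0 i0 k2 !expg0 !mulg1.
have [-> _ _] := rot _ d1; have [_ -> _] := rot _ d2; have [_ _ ->] := rot _ d3.
by rewrite !mul1g.
Qed.
End PrismPresentation.

(** * The minimal regular cover *)

Section MinimalCover.
Variable n : nat.
Hypothesis hn : (3 <= n)%N.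
Local Notation cover := (prism_cover n).

Let gr := prism_gr hn.
Let dia := prism_diamond hn.
Let reg : is_regular cover := @prism_cover_regular n.

Lemma prism_cover_covers (F : flag cover) : covers F (prism n).
Proof. by apply/(covers_walks _ reg gr dia) => w /(prism_cover_walk_prism hn). Qed.

Lemma covers_prism_cover d (P : tbPOrderType d) (Phi : flag P) :
  is_regular P -> covers Phi (prism n) -> covers Phi cover.
Proof.
move=> rP /(covers_walks _ rP gr dia) H.
apply/(covers_walks _ rP (polyhedron_graded reg.1) (polyhedron_diamond reg.1)) => w wP F.
exact/(prism_cover_walk_prism hn)/H.
Qed.

(** If R covers the prism and is covered by this polyhedron, then the words returning to
its base flag are again the words acting trivially on the prism, so [iso_of_walks]
applies. *)
Lemma prism_cover_minimal (F : flag cover) : minimal_regular_cover F (prism n).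
Proof.
split=> [||dR R Psi rR /(covers_walks _ rR gr dia) RQ]; first exact: reg.
  exact: prism_cover_covers.
move=> /(covers_walks _ reg (polyhedron_graded rR.1) (polyhedron_diamond rR.1)) FR.
have [|f [g [fK gK fM _]]] := iso_of_walks (Phi := Psi) (Psi := F) rR.1 reg.1.
  by move=> w; split=> [/RQ/(prism_cover_walk_prism hn)|/FR].
by exists f; split=> //; exists g.
Qed.

(** A minimal regular cover P covers [prism_cover], so by minimality they are isomorphic.
By regularity of P the isomorphism may be taken to preserve base flags. *)
Lemma minimal_cover_walk d (P : tbPOrderType d) (Phi : flag P) w :
  minimal_regular_cover Phi (prism n) ->
  walk Phi w = Phi <-> eval (@dart_perm n) w = 1%g.
Proof.
move=> [rP cP minP]; have [F _] := le_flag (lexx (\bot : cover)).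
have [f [[g fK gK] fM]] := minP _ _ F reg (prism_cover_covers F) (covers_prism_cover rP cP).
have grP := polyhedron_graded rP.1; have diaP := polyhedron_diamond rP.1.
have [h <-] := regular_act rP (image_flag fK gK fM F) Phi.
rewrite -(prism_cover_walk F) -(act_walk rP.1); split=> [|wF].
  rewrite -(image_walk fK gK fM (polyhedron_graded reg.1) grP (polyhedron_diamond reg.1) diaP).
  by move=> /(image_flag_inj grP grP)/(image_flag_inj (polyhedron_graded reg.1) grP).
by rewrite -(image_walk fK gK fM (polyhedron_graded reg.1) grP (polyhedron_diamond reg.1) diaP)
  wF.
Qed.
End MinimalCover.

Theorem theorem8 (n : nat) (hn : (3 <= n)%N) :
  (exists (d : Order.disp_t) (P : tbPOrderType d) (Phi : flag P),
     minimal_regular_cover Phi (prism n)) /\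
  (forall (d : Order.disp_t) (P : tbPOrderType d) (Phi : flag P),
     minimal_regular_cover Phi (prism n) ->
     has_presentation (rho Phi)
       (fun w => w \in rcons (coxeter_relators (lcmn 4 n) 3) extra_relator)).
Proof.
split=> [|d P Phi PhiP].
  have [F _] := le_flag (lexx (\bot : prism_cover n)).
  by exists _, _, F; apply: prism_cover_minimal.
have rP : is_regular P by case: PhiP.
apply: has_presentation_eq1; first exact: rho_generate rP.1 rP Phi.
move=> w; rewrite -(prism_presentation hn) -(minimal_cover_walk hn _ PhiP).
exact: (eval_rho_eq1 rP.1 rP).
Qed.
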